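(* Let $u$ be a non-constant inner function and let $\mathcal{A}$ be an algebra (of bounded operators on $K_u^2$) contained in $\mathcal{T}_u$. Then there exists $\alpha\in\mathbb{C}\cup\{\infty\}$ such that $\mathcal{A}$ is a subalgebra of $\mathcal{B}^\alpha$.
   Context: $\mathbb{T}$ is the unit circle with normalized Lebesgue measure $m$, $H^2\subset L^2(\mathbb{T})$ is the Hardy space, $u$ is a non-constant inner function, $K_u^2=H^2\ominus uH^2$, $P_u:L^2(\mathbb{T})\to K_u^2$ is the orthogonal projection, and $K_u^\infty$ is the (dense) set of bounded functions in $K_u^2$. For $\Phi\in L^2(\mathbb{T})$, the truncated Toeplitz operator $A_\Phi$ is defined on $K_u^\infty$ by $A_\Phi f=P_u(\Phi f)$. $\mathcal{T}_u$ is the set of those operators $A_\Phi$ that extend to bounded operators on $K_u^2$ (identified with their bounded extensions). $\Phi$ is called a symbol of $A$ if $A=A_\Phi$; symbols are not unique. On $K_u^2$: $Cf=u\overline{zf}$ (an antilinear isometric involution of $K_u^2$), and $S_uf=P_u(zf)$. Type: an operator $A\in\mathcal{T}_u$ is of type $\alpha\in\mathbb{C}$ if it has a symbol of the form $\varphi+\alpha\overline{S_uC\varphi}+c$ with $\varphi\in K_u^2$ and $c\in\mathbb{C}$. $A\in\mathcal{T}_u$ is of type $\infty$ if it has an antiholomorphic symbol, i.e. a symbol $\overline{\psi}$ with $\psi\in H^2$. For $\alpha\in\mathbb{C}\cup\{\infty\}$, $\mathcal{B}^\alpha$ denotes the set of all operators in $\mathcal{T}_u$ of type $\alpha$; it is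 a weakly closed commutative algebra. *)

(* Defs.v *)
From HB Require Import structures.
From mathcomp Require Import all_boot all_order all_algebra.
From mathcomp Require Import complex.
From mathcomp Require Import all_classical all_reals all_analysis.

Set Implicit Arguments.
Unset Strict Implicit.
Unset Printing Implicit Defensive.

Import Order.TTheory GRing.Theory Num.Theory.
Import numFieldNormedType.Exports.

Local Open Scope classical_set_scope.
Local Open Scope ring_scope.
Local Open Scope complex_scope.

Record circle (R : realType) : Type :=
  Circle { circle_val :> R[i]; circle_valP : `|circle_val| == 1 }.

HB.instance Definition _ (R : realType) := [isSub for @circle_val R].
HB.instance Definition _ (R : realType) := [Choice of circle R by <:].

Lemma expi_subproof (R : realType) (t : R) :
  `|cos (2 * pi * t) +i* sin (2 * pi * t)| == 1.
Proof. by rewrite normc_def /= cos2Dsin2 sqrtr1. Qed.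

(* t |-> exp (2 i pi t) *)
Definition expi (R : realType) (t : measurableTypeR R) : circle R :=
  Circle (expi_subproof t).

(* The Borel sigma-algebra of the circle, presented as the final structure for
   the periodic map expi: since expi restricts to a Borel isomorphism from
   [0, 1[ onto the circle, A is Borel if and only if its preimage is. *)
Section circle_measurable.
Context (R : realType).

HB.instance Definition _ := isPointed.Build (circle R) (expi 0).

Definition circle_borel : set (set (circle R)) :=
  [set A | measurable (@expi R @^-1` A)].

Let circle_borel0 : circle_borel set0.
Proof. by rewrite /circle_borel /= preimage_set0. Qed.

Let circle_borelC A : circle_borel A -> circle_borel (~` A).
Proof. by rewrite /circle_borel /= preimage_setC => /measurableC. Qed.

Let circle_borel_bigcup (F : (set (circle R))^nat) :
  (forall i, circle_borel (F i)) -> circle_borel (\bigcup_i F i).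
Proof.
by move=> mF; rewrite /circle_borel /= preimage_bigcup; exact: bigcupT_measurable.
Qed.

HB.instance Definition _ := isMeasurable.Build default_measure_display
  (circle R) circle_borel0 circle_borelC circle_borel_bigcup.

Lemma measurable_expi : measurable_fun [set: measurableTypeR R] (@expi R).
Proof. by move=> _ A mA; rewrite setTI. Qed.

HB.instance Definition _ :=
  isMeasurableFun.Build _ _ (measurableTypeR R) (circle R) (@expi R)
    measurable_expi.

Definition arc_measure : set (circle R) -> \bar R :=
  pushforward
    (mrestr (@lebesgue_measure R) (@measurable_itv R `[0%R, 1%R[)) (@expi R).

Let arc_measure0 : arc_measure set0 = 0%E.
Proof. exact: measure0. Qed.

Let arc_measure_ge0 A : (0 <= arc_measure A)%E.
Proof. exact: measure_ge0. Qed.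

Let arc_measure_sigma_additive : semi_sigma_additive arc_measure.
Proof. exact: measure_semi_sigma_additive. Qed.

HB.instance Definition _ := isMeasure.Build _ _ _ arc_measure
  arc_measure0 arc_measure_ge0 arc_measure_sigma_additive.

Let arc_measure_setT : arc_measure setT = 1%E.
Proof.
rewrite /arc_measure /pushforward preimage_setT /mrestr setTI.
by rewrite lebesgue_measure_itv /= lte_fin ltr01 oppr0 adde0.
Qed.

HB.instance Definition _ :=
  Measure_isProbability.Build _ _ _ arc_measure arc_measure_setT.

End circle_measurable.

Section hardy.
Context (R : realType).
Local Notation C := R[i].
Local Notation m := (@arc_measure R).

Implicit Types f g u : circle R -> C.

(* Elements of L^2 are represented by functions; equality in L^2 is equality
   almost everywhere. *)
Definition L2 f : Prop :=
  ((fun z => complex.Re (f z)) \in Lfun m 2%:E) /\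
  ((fun z => complex.Im (f z)) \in Lfun m 2%:E).

Definition cintegral f : C :=
  (\int[m]_z complex.Re (f z)) +i* (\int[m]_z complex.Im (f z)).

Definition inner f g : C := cintegral (fun z => f z * (g z)^*).

Definition norm2 f : R := Num.sqrt (complex.Re (inner f f)).

Definition fourier f (n : int) : C := inner f (fun z => circle_val z ^ n).

Definition H2 f : Prop := L2 f /\ forall n : int, (n < 0)%R -> fourier f n = 0.

Definition ess_bounded f : Prop :=
  exists M : R, \forall z \ae m, `|f z| <= M%:C.

Definition inner_function u : Prop := H2 u /\ \forall z \ae m, `|u z| = 1.

Definition nonconstant u : Prop :=
  ~ exists c : C, \forall z \ae m, u z = c.

Definition model u f : Prop :=
  H2 f /\ forall g, H2 g -> inner f (fun z => u z * g z) = 0.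

Definition model_bounded u f : Prop := model u f /\ ess_bounded f.

(* g is (a representative of) P_u f *)
Definition model_proj u f g : Prop :=
  model u g /\ forall h, model u h -> inner (fun z => f z - g z) h = 0.

Definition conjugation u f : circle R -> C :=
  fun z => u z * (circle_val z * f z)^*.

(* g is (a representative of) S_u f *)
Definition compressed_shift u f g : Prop :=
  model_proj u (fun z => circle_val z * f z) g.

Definition operator : Type := (circle R -> C) -> (circle R -> C).

Implicit Types A B : operator.

Definition eq_operator u A B : Prop :=
  forall f, model u f -> \forall z \ae m, A f z = B f z.

Record bounded_operator u A : Prop := {
  bounded_operator_model : forall f, model u f -> model u (A f) ;
  bounded_operator_ae : forall f g, model u f -> model u g ->
    (\forall z \ae m, f z = g z) -> \forall z \ae m, A f z = A g z ;
  bounded_operator_linear : forall (a : C) f g, model u f -> model u g ->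
    \forall z \ae m, A (fun w => a * f w + g w) z = a * A f z + A g z ;
  bounded_operator_bound : exists M : R, forall f, model u f ->
    norm2 (A f) <= M * norm2 f }.

Definition symbol u A (Phi : circle R -> C) : Prop :=
  L2 Phi /\
  forall f, model_bounded u f -> model_proj u (fun z => Phi z * f z) (A f).

Definition tto u : set operator :=
  [set A | bounded_operator u A /\ exists Phi, symbol u A Phi].

Definition finite_type u (alpha : C) A : Prop :=
  exists phi s (c : C), [/\ model u phi,
    compressed_shift u (conjugation u phi) s &
    symbol u A (fun z => phi z + alpha * (s z)^* + c)].

Definition infinite_type u A : Prop :=
  exists psi, H2 psi /\ symbol u A (fun z => (psi z)^*).

(* None stands for the point at infinity of the extended complex plane. *)
Definition tto_of_type u (alpha : option C) : set operator :=
  [set A | tto u A /\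
    if alpha is Some a then finite_type u a A else infinite_type u A].

(* Sets of operators on the model space are represented by sets closed under
   eq_operator; algebras are not required to contain the identity. *)
Record operator_algebra u (Alg : set operator) : Prop := {
  operator_algebra_bounded : forall A, Alg A -> bounded_operator u A ;
  operator_algebra_eq : forall A B, Alg A -> bounded_operator u B ->
    eq_operator u A B -> Alg B ;
  operator_algebra_zero : Alg (fun _ _ => 0) ;
  operator_algebra_add : forall A B, Alg A -> Alg B ->
    Alg (fun f z => A f z + B f z) ;
  operator_algebra_scale : forall (a : C) A, Alg A ->
    Alg (fun f z => a * A f z) ;
  operator_algebra_comp : forall A B, Alg A -> Alg B -> Alg (fun f => A (B f)) }.

Definition subalgebra u (Alg Alg' : set operator) : Prop :=
  operator_algebra u Alg /\ Alg `<=` Alg'.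

End hardy.

(* Main.v *)
Require Import Defs.
From mathcomp Require Import all_boot all_order all_algebra.
From mathcomp Require Import complex.
From mathcomp Require Import all_classical all_reals all_analysis.
From mathcomp Require Import measurable_realfun.
From mathcomp Require Import ring lra.

Set Implicit Arguments.
Unset Strict Implicit.
Unset Printing Implicit Defensive.
Import Order.TTheory GRing.Theory Num.Theory.
Import numFieldNormedType.Exports.
Local Open Scope classical_set_scope.
Local Open Scope complex_scope.
Local Open Scope ring_scope.

(* Write [u(0)] for the mean of [u], [J g = u conj g] and [K0] for the bounded
   functions of the model space vanishing at the origin.  A symbol [Phi] acts
   on [K0] through two functionals, [p(g)] = integral of Phi conj g and
   [r(g)] = integral of Phi (J g).

   A truncated Toeplitz operator [D] satisfies <D f, g> = <D (f/z), g/z> for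
   [f], [g] in [K0].  Applying this to [D = A B], and expressing [B f] and
   [A^* g] through [B (f/z)] and [A^* (g/z)] (the adjoint of [A] has the
   conjugate symbol), leaves exactly r_B(f) p_A(g) = p_B(f) r_A(g).  So in an
   algebra either all [p] vanish, or r_B = alpha p_B for one common alpha.

   Both functionals are represented by elements phi, chi of the model space,
   obtained from [A k] and [A (C k)], where [k] is the kernel at the origin.
   A symbol with vanishing [p] and [r] defines a multiple of the identity, so
   phi + conj (S C chi) + constant is a symbol of the operator: it is of type
   alpha when chi = alpha phi, and antiholomorphic when phi = 0. *)

(** * Density of trigonometric polynomials *)

(** The product is examined through <B f, A^* g> because [B f] need not be bounded, while a symbol
    of [A] describes [A] on bounded functions only. The identity <A h, g> = <h, A^* g> for unbounded
    [h] comes from approximating [h] by bounded functions. Density is used again to show that a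
    symbol with vanishing functionals acts trivially. The dense set is the span of the vectors S_u^n
    k, which contains the projections of the polynomials. Polynomials are dense in H^2 because
    trigonometric polynomials are dense in L^2, and this is derived from the indicators of arcs. No
    projection theorem enters: every projection that occurs is exhibited by a formula and checked.

    Functions vanishing at the origin are singled out because dividing them by z stays in the model
    space; among bounded functions, [k] spans a complement. Non-constancy of [u] gives 1 - |u(0)|^2
    <> 0, a number that is both the squared norm of [k] and the determinant of the linear system
    yielding phi and chi. *)

Section l2_closure.
Import HBNNSimple.
Context d (T : measurableType d) (R : realType).
Variables (mu : {finite_measure set T -> \bar R}) (S : set (T -> R)).
Implicit Types f g h : T -> R.

(** The squared distance: keeping the square avoids roots of extended reals and costs a factor 2 in
    the triangle inequality, hence the quarters of [e] below. *)
Definition l2dist f g : \bar R := (\int[mu]_x ((f x - g x) ^+ 2)%:E)%E.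

Definition l2_closure f : Prop := measurable_fun setT f /\
  forall e : R, 0 < e -> exists2 t, S t & (l2dist f t < e%:E)%E.

Hypothesis S_measurable : forall f, S f -> measurable_fun setT f.
Hypothesis S_add : forall f g, S f -> S g -> S (fun x => f x + g x).
Hypothesis S_scale : forall (a : R) f, S f -> S (fun x => a * f x).

Let mfun2 f g : measurable_fun setT f -> measurable_fun setT g ->
  measurable_fun setT (fun x => ((f x - g x) ^+ 2 : R)%:E).
Proof.
by move=> mf mg; apply/measurable_EFinP; apply: measurable_funX; exact: measurable_funB.
Qed.

Lemma l2dist_triangle f g h : measurable_fun setT f -> measurable_fun setT g ->
  measurable_fun setT h ->
  (l2dist f h <= 2%:E * l2dist f g + 2%:E * l2dist g h)%E.
Proof.
move=> mf mg mh; rewrite /l2dist -!ge0_integralZl//; first last.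
- by move=> x _; rewrite lee_fin sqr_ge0.
- exact: mfun2.
- by move=> x _; rewrite lee_fin sqr_ge0.
- exact: mfun2.
rewrite -ge0_integralD//; first last.
- by apply: measurable_funeM; exact: mfun2.
- by move=> x _; rewrite mule_ge0// lee_fin sqr_ge0.
- by apply: measurable_funeM; exact: mfun2.
- by move=> x _; rewrite mule_ge0// lee_fin sqr_ge0.
apply: ge0_le_integral => //.
- by move=> x _; rewrite lee_fin sqr_ge0.
- exact: mfun2.
- by apply: emeasurable_funD; apply: measurable_funeM; exact: mfun2.
- move=> x _; rewrite -!EFinM -EFinD lee_fin.
  have := sqr_ge0 ((f x - g x) - (g x - h x)); nra.
Qed.

Lemma l2_closure_lim f : measurable_fun setT f ->
  (forall e : R, 0 < e -> exists2 g, l2_closure g & (l2dist f g < e%:E)%E) ->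
  l2_closure f.
Proof.
move=> mf H; split => // e e0.
have e4 : 0 < e / 4 by lra.
have [g [mg Hg] fg] := H _ e4; have [t St gt] := Hg _ e4.
exists t => //; apply: (le_lt_trans (l2dist_triangle mf mg (S_measurable St))).
have -> : (e%:E = 2%:E * (e / 4)%:E + 2%:E * (e / 4)%:E)%E.
  by rewrite -!EFinM -EFinD; congr EFin; field.
by rewrite lteD// lte_pmul2l.
Qed.

Lemma l2_closure_sub f : S f -> l2_closure f.
Proof.
move=> Sf; split; first exact: S_measurable.
move=> e e0; exists f => //; rewrite /l2dist.
by under eq_integral do rewrite subrr expr0n; rewrite integral0 lte_fin.
Qed.

Lemma l2_closure_add f g : l2_closure f -> l2_closure g ->
  l2_closure (fun x => f x + g x).
Proof.
move=> [mf Hf] [mg Hg]; split; first exact: measurable_funD.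
move=> e e0; have e4 : 0 < e / 4 by lra.
have [s Ss fs] := Hf _ e4; have [t St gt] := Hg _ e4.
exists (fun x => s x + t x); first exact: S_add.
have ms := S_measurable Ss; have mt := S_measurable St.
have mst : measurable_fun setT (fun x => s x + t x) by exact: measurable_funD.
have mgs : measurable_fun setT (fun x => s x + g x) by exact: measurable_funD.
have mfg : measurable_fun setT (fun x => f x + g x) by exact: measurable_funD.
apply: (le_lt_trans (l2dist_triangle mfg mgs mst)).
have -> : (e%:E = 2%:E * (e / 4)%:E + 2%:E * (e / 4)%:E)%E.
  by rewrite -!EFinM -EFinD; congr EFin; field.
rewrite lteD// lte_pmul2l//.
  rewrite /l2dist; under eq_integral do rewrite opprD addrACA subrr addr0.
  exact: fs.
rewrite /l2dist; under eq_integral do rewrite opprD addrACA subrr add0r.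
exact: gt.
Qed.

Lemma l2_closure_scale a f : l2_closure f -> l2_closure (fun x => a * f x).
Proof.
move=> [mf Hf]; split; first exact: measurable_funM.
move=> e e0; have a0 : 0 < a ^+ 2 + 1 by rewrite ltr_wpDl// sqr_ge0.
have [s Ss fs] := Hf _ (divr_gt0 e0 a0).
have ms := S_measurable Ss.
exists (fun x => a * s x); first exact: S_scale.
rewrite /l2dist; under eq_integral => x _ do
  rewrite -mulrBr exprMn EFinM.
rewrite ge0_integralZl//; first last.
- by rewrite lee_fin sqr_ge0.
- by move=> x _; rewrite lee_fin sqr_ge0.
- exact: mfun2.
have -> : e = (a ^+ 2 + 1) * (e / (a ^+ 2 + 1)) by field; exact: lt0r_neq0.
rewrite [ltRHS]EFinM; apply: (@le_lt_trans _ _ ((a ^+ 2 + 1)%:E * l2dist f s)%E).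
  apply: lee_wpmul2r; last by rewrite lee_fin lerDl.
  by apply: integral_ge0 => x _; rewrite lee_fin sqr_ge0.
by rewrite lte_pmul2l// lte_fin.
Qed.

Lemma l2_closure_sum (I : Type) (r : seq I) (F : I -> T -> R) : S (fun=> 0) ->
  (forall i, l2_closure (F i)) -> l2_closure (fun x => \sum_(i <- r) F i x).
Proof.
move=> S0 HF; elim: r => [|i r IH].
  by under eq_fun do rewrite big_nil; exact: l2_closure_sub.
by under eq_fun do rewrite big_cons; exact: l2_closure_add.
Qed.

(** The integrand [(f - F n)^2] tends to 0 almost everywhere and is at most [(2 g)^2], which
    accounts for the factor 4. *)
Lemma l2_closure_dominated f (F : nat -> T -> R) g :
  measurable_fun setT f -> (forall n, l2_closure (F n)) ->
  (\forall x \ae mu, F ^~ x @ \oo --> f x) ->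
  (forall n x, `|F n x| <= g x) -> (forall x, `|f x| <= g x) ->
  mu.-integrable setT (fun x => (g x ^+ 2)%:E) -> l2_closure f.
Proof.
move=> mf lF Ff Fg fg ig; apply: l2_closure_lim => // e e0.
have mF n : measurable_fun setT (F n) by have [] := lF n.
have [||||| _ + _] := @dominated_convergence _ _ _ mu setT measurableT
  (fun n x => ((f x - F n x) ^+ 2)%:E) (cst 0%E) (fun x => 4%:E * (g x ^+ 2)%:E)%E.
- by move=> n; exact: mfun2.
- exact: measurable_cst.
- apply: filterS Ff => x Ff _; apply: cvg_EFin; first by near=> n.
  have fF : f x - F n x @[n --> \oo] --> (0 : R).
    by rewrite -[X in _ --> X](subrr (f x)); apply: cvgB; [exact: cvg_cst|exact: Ff].
  have fF2 := cvgM fF fF; rewrite mulr0 in fF2.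
  rewrite (_ : _ \o _ = (fun n => f x - F n x) \* (fun n => f x - F n x))//.
  exact: fF2.
- exact: integrableZl.
- apply: aeW => x n _; rewrite /= ger0_norm ?sqr_ge0// -EFinM lee_fin.
  have := fg x; have := Fg n x; rewrite !ler_norml => /andP[? ?] /andP[? ?]; nra.
move/fine_cvgP => [fin /cvgrPdist_lt/(_ e e0) H].
pose I n := (\int[mu]_x `|((f x - F n x) ^+ 2)%:E - cst 0%E x|)%E.
near \oo => n; exists (F n) => //.
have -> : l2dist f (F n) = I n.
  by apply: eq_integral => x _; rewrite sube0 gee0_abs// lee_fin sqr_ge0.
have finI : I n \is a fin_num by near: n.
have : `|0 - fine (I n)| < e by near: n.
by rewrite sub0r normrN -(fineK finI) lte_fin; apply: le_lt_trans; exact: ler_norm.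
Unshelve. all: by end_near. Qed.

Hypothesis S_cst : forall a : R, S (fun=> a).

(** Sets whose indicator lies in the closure form a Dynkin system: complements are [1 - \1_B], and
    disjoint unions are bounded limits of partial sums. A generating pi-system therefore
    suffices. *)
Lemma l2_closure_indic (G : set (set T)) : @measurable d T = <<s G >> -> setI_closed G ->
  (forall A, G A -> l2_closure \1_A) -> forall A, measurable A -> l2_closure \1_A.
Proof.
move=> mG GI lG A mA; have cst_closure a := l2_closure_sub (S_cst a).
suff : [set A | l2_closure \1_A] A by [].
move: mA; rewrite {1}mG; apply: (dynkin_induction mG GI) => //=.
- by rewrite indicT; exact: cst_closure.
- move=> B mB lB; rewrite (_ : \1_(~` B) = (fun x => 1 + (-1) * \1_B x)).
    by apply: l2_closure_add => //; exact: l2_closure_scale.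
  by apply/funext => x; rewrite !indicE in_setC; case: (_ \in B); rewrite /= ?mulr1 ?mulr0 ?subrr ?addr0.
- move=> F mF tF lF.
  have F0 x k : (0 <= (\1_(F k) x : R)%:E)%E by rewrite lee_fin indicE; case: (_ \in _).
  have Fcvg x : (fun n => \sum_(0 <= k < n) (\1_(F k) x : R)%:E)%E @ \oo -->
      (\1_(\bigcup_k F k) x)%:E.
    by rewrite indic_bigcup//; apply: is_cvg_nneseries => k _ _; exact: F0.
  apply: (@l2_closure_dominated _ (fun n x => \sum_(0 <= k < n) \1_(F k) x) (fun=> 1)).
  + by apply: measurable_indic; exact: bigcup_measurable.
  + by move=> n; apply: l2_closure_sum.
  + apply: aeW => x; have := Fcvg x => /fine_cvgP[_]; under eq_fun do rewrite /= sumEFin.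
    exact.
  + move=> n x; rewrite ger0_norm; last by apply: sumr_ge0 => k _; rewrite -lee_fin.
    rewrite -lee_fin -sumEFin; apply: (@le_trans _ _ (\1_(\bigcup_k F k) x)%:E).
      by rewrite indic_bigcup//; apply: nneseries_lim_ge => k _ _; exact: F0.
    by rewrite lee_fin indicE; case: (_ \in _).
  + by move=> x; rewrite indicE; case: (_ \in _); rewrite ?normr1 ?normr0.
  + exact: finite_measure_integrable_cst.
Qed.

Hypothesis indic_closure : forall A, measurable A -> l2_closure \1_A.

Lemma l2_closure_ge0 f : measurable_fun setT f -> (forall x, 0 <= f x) ->
  mu.-integrable setT (fun x => (f x ^+ 2)%:E) -> l2_closure f.
Proof.
move=> mf f0 if2.
have mEf : measurable_fun setT (EFin \o f) by exact/measurable_EFinP.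
apply: (@l2_closure_dominated f (fun n x => nnsfun_approx measurableT mEf n x) f) => //.
- move=> n; pose h := nnsfun_approx measurableT mEf n.
  rewrite -/h (_ : (h : T -> R) = (fun x => \sum_(y <- finmap.enum_fset (fset_set (range h))) y * \1_(h @^-1` [set y]) x)).
    by apply: l2_closure_sum => // y; apply: l2_closure_scale; apply: indic_closure.
  by apply/funext => x; rewrite fimfunE fsbig_finite.
- apply: aeW => x; have := @cvg_nnsfun_approx _ _ _ _ measurableT _ mEf (fun x _ => f0 x) x I.
  by move/fine_cvgP => [].
- move=> n x; rewrite ger0_norm//; rewrite -lee_fin nnsfun_approxE.
  exact: (@le_approx _ _ _ setT (EFin \o f) n x (fun x _ => f0 x) I).
- by move=> x; rewrite ger0_norm.
Qed.

Lemma l2_closure_sqr_integrable f : measurable_fun setT f ->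
  mu.-integrable setT (fun x => (f x ^+ 2)%:E) -> l2_closure f.
Proof.
move=> mf if2.
have mn : measurable_fun setT (fun x => `|f x|) by exact: measurableT_comp.
(* Both [|f|] and [|f| - f] are nonnegative, and the square of the second is at most [4 f^2]. *)
rewrite (_ : f = fun x => `|f x| + (-1) * (`|f x| - f x)); last first.
  by apply/funext => x; rewrite mulN1r opprB addrCA subrr addr0.
apply: l2_closure_add; last apply: l2_closure_scale.
- by apply: l2_closure_ge0 => //; under eq_fun do rewrite real_normK ?num_real//.
- apply: l2_closure_ge0.
  + exact: measurable_funB.
  + by move=> x; rewrite subr_ge0 ler_norm.
  + apply: (@le_integrable _ _ _ _ _ measurableT _ (fun x => 4%:E * (f x ^+ 2)%:E)%E).
    * by apply/measurable_EFinP; apply: measurable_funX; exact: measurable_funB.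
    * move=> x _; rewrite /= lee_fin (ger0_norm (sqr_ge0 _)) (@ger0_norm _ (4 * _)); last by apply: mulr_ge0 => //; exact: sqr_ge0.
      have := real_normK (num_real (f x)); have := sqr_ge0 (`|f x| + f x); nra.
    * exact: integrableZl.
Qed.

End l2_closure.

(** * Polynomial approximation of a step function *)

Section threshold.
Context {R : realType}.
Implicit Types (x y r : R) (n : nat).

Lemma bernoulli_inequality x n : -1 <= x -> 1 + n%:R * x <= (1 + x) ^+ n.
Proof.
move=> x1; elim: n => [|n IH]; first by rewrite mul0r addr0 expr0.
rewrite exprS; apply: (@le_trans _ _ ((1 + x) * (1 + n%:R * x))).
  by rewrite -natr1; have := mulr_ge0 (ler0n R n) (sqr_ge0 x); nra.
by rewrite ler_wpM2l//; lra.
Qed.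

(** With [s = (1 + r) / 2] one has [r <= s^2], while Bernoulli applied to [1 / s] bounds [n s^n] by
    [1 / (1 - s)]; so [n r^n] is at most a constant times [s^n]. *)
Lemma cvg_natrM_expr r : 0 <= r < 1 -> (fun n => n%:R * r ^+ n) @ \oo --> (0 : R).
Proof.
move=> /andP[r0 r1]; pose s := (1 + r) / 2.
have s0 : 0 < s by rewrite /s; lra.
have s1 : s < 1 by rewrite /s; lra.
have rs : r <= s ^+ 2 by rewrite /s; have := sqr_ge0 (1 - r); nra.
have sn n : n%:R * s ^+ n <= (1 - s)^-1.
  rewrite -[leRHS]mul1r ler_pdivlMr ?subr_gt0//.
  have sV : s^-1 = 1 + (s^-1 - 1) by rewrite addrCA subrr addr0.
  have h : -1 <= s^-1 - 1 by rewrite lerBrDl subrr invr_ge0 ltW.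
  have := bernoulli_inequality n h; rewrite -sV exprVn => hb.
  have h2 : n%:R * (1 - s) <= (s ^+ n)^-1.
    apply: le_trans hb; rewrite ler_wpDl// ler_wpM2l//.
    have v0 : 0 <= s^-1 by rewrite invr_ge0 ltW.
    have := mulr_ge0 v0 (sqr_ge0 (1 - s)); have := divff (lt0r_neq0 s0); nra.
  by rewrite mulrAC -ler_pdivlMr ?exprn_gt0// mul1r.
apply: (@squeeze_cvgr _ _ _ _ (fun=> 0) (fun n => (1 - s)^-1 * s ^+ n)).
- near=> n; rewrite mulr_ge0 ?exprn_ge0//=.
  apply: (@le_trans _ _ (n%:R * s ^+ n * s ^+ n)).
    by rewrite -mulrA -exprD addnn -mul2n exprM ler_wpM2l// lerXn2r// nnegrE ?exprn_ge0// ltW.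
  by rewrite ler_wpM2r// exprn_ge0// ltW.
- exact: cvg_cst.
- rewrite -[X in _ --> X](mulr0 (1 - s)^-1); apply: cvgMr.
  by apply: cvg_expr; rewrite ger0_norm ?ltW.
Unshelve. all: by end_near. Qed.

(* Polynomials converging boundedly to the indicator of [y < 1/2] on [0, 1]. *)
Definition threshold n y : R := (1 - y ^+ n) ^+ (n * 2 ^ n).

Lemma threshold_itv n y : 0 <= y <= 1 -> 0 <= threshold n y <= 1.
Proof.
move=> /andP[y0 y1]; have yn : 0 <= y ^+ n <= 1 by rewrite exprn_ge0//= exprn_ile1.
by rewrite /threshold exprn_ge0 ?exprn_ile1 //; lra.
Qed.

(* By Bernoulli's inequality, with [k = n 2^n], the threshold is at least
   [1 - k y^n] and at most [(1 + y^n)^(-k) <= 1 / (1 + k y^n)]. *)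
Lemma cvg_threshold y : 0 <= y <= 1 ->
  (fun n => threshold n y) @ \oo --> ((y < 2^-1)%R%:R : R).
Proof.
move=> /[dup] y01 /andP[y0 y1].
have yn n : 0 <= y ^+ n <= 1 by rewrite exprn_ge0//= exprn_ile1.
(* The base 2 puts the jump at 1/2. The extra factor [n] settles the point [y = 1/2] itself: with
   exponent [2^n] alone the limit there would be [1/e]. *)
have natE n : (n * 2 ^ n)%:R * y ^+ n = n%:R * (2 * y) ^+ n.
  by rewrite natrM natrX exprMn mulrA.
case: ltP => y2.
- apply: (@squeeze_cvgr _ _ _ _ (fun n => 1 - n%:R * (2 * y) ^+ n) (fun=> 1)).
  + near=> n; have /andP[_ ->] := threshold_itv n y01.
    rewrite andbT -natE -mulrN; apply: bernoulli_inequality.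
    by have := yn n; lra.
  + rewrite -[X in _ --> X](subr0 1); apply: cvgB; first exact: cvg_cst.
    by apply: cvg_natrM_expr; lra.
  + exact: cvg_cst.
- apply: (@squeeze_cvgr _ _ _ _ (fun=> 0) harmonic); last 2 first.
  + exact: cvg_cst.
  + exact: cvg_harmonic.
  near=> n; have /andP[-> _] := threshold_itv n y01.
  rewrite /harmonic /= -[leRHS]mul1r ler_pdivlMr//.
  have h : -1 <= y ^+ n by have := yn n; lra.
  have hb := bernoulli_inequality (n * 2 ^ n) h.
  apply: (@le_trans _ _ (threshold n y * (1 + y ^+ n) ^+ (n * 2 ^ n))).
    apply: ler_wpM2l; first by have /andP[] := threshold_itv n y01.
    apply: le_trans hb; rewrite natE -natr1 addrC lerD2l ler_peMr//.
    by apply: exprn_ege1; lra.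
  rewrite /threshold -exprMn; apply: exprn_ile1; have := yn n; nra.
Unshelve. all: by end_near. Qed.
End threshold.

(** * Measurability of complex-valued functions *)

Section cmeasurable.
Context d (T : measurableType d) (R : realType).
Implicit Types f g : T -> R[i].

Definition cmeasurable f : Prop :=
  measurable_fun setT (fun x => complex.Re (f x)) /\
  measurable_fun setT (fun x => complex.Im (f x)).

Lemma cmeasurable_cst (c : R[i]) : cmeasurable (fun=> c).
Proof. by split; exact: measurable_cst. Qed.

Lemma cmeasurableD f g : cmeasurable f -> cmeasurable g ->
  cmeasurable (fun x => f x + g x).
Proof.
move=> [rf jf] [rg jg]; split.
  by under eq_fun do rewrite raddfD; exact: measurable_funD.
by under eq_fun do rewrite raddfD; exact: measurable_funD.
Qed.

Lemma cmeasurableM f g : cmeasurable f -> cmeasurable g ->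
  cmeasurable (fun x => f x * g x).
Proof.
move=> [rf jf] [rg jg]; split.
  rewrite (_ : (fun _ => _) = (fun x => complex.Re (f x) * complex.Re (g x) -
    complex.Im (f x) * complex.Im (g x))); last first.
    by apply/funext => x; case: (f x) => a b; case: (g x).
  by apply: measurable_funB; exact: measurable_funM.
rewrite (_ : (fun _ => _) = (fun x => complex.Re (f x) * complex.Im (g x) +
    complex.Im (f x) * complex.Re (g x))); last first.
  by apply/funext => x; case: (f x) => a b; case: (g x).
by apply: measurable_funD; exact: measurable_funM.
Qed.

Lemma cmeasurable_conj f : cmeasurable f -> cmeasurable (fun x => (f x)^*).
Proof.
move=> [rf jf]; split.
  by rewrite (_ : (fun _ => _) = (fun x => complex.Re (f x)))//; apply/funext => x; case: (f x).
rewrite (_ : (fun _ => _) = (fun x => - complex.Im (f x))); first exact: measurableT_comp.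
by apply/funext => x; case: (f x).
Qed.

Lemma cmeasurableX f n : cmeasurable f -> cmeasurable (fun x => f x ^+ n).
Proof.
move=> mf; elim: n => [|n IH]; first by under eq_fun do rewrite expr0; exact: cmeasurable_cst.
by under eq_fun do rewrite exprS; exact: cmeasurableM.
Qed.

Lemma cmeasurable_horner f (P : {poly R[i]}) : cmeasurable f ->
  cmeasurable (fun x => P.[f x]).
Proof.
move=> mf; elim/poly_ind: P => [|P c IH].
  by under eq_fun do rewrite horner0; exact: cmeasurable_cst.
under eq_fun do rewrite hornerMXaddC.
by apply: cmeasurableD; [exact: cmeasurableM|exact: cmeasurable_cst].
Qed.

End cmeasurable.

(** * Trigonometric polynomials on the unit interval *)

Section trigonometric.
Context {R : realType}.
Local Notation expi := (@expi R).

Lemma cmeasurable_expi : cmeasurable (fun t : measurableTypeR R => circle_val (expi t)).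
Proof.
split; rewrite /Defs.expi /=.
  apply: (measurableT_comp (f := @cos R)); last exact: measurable_funM.
  by apply: continuous_measurable_fun; exact: continuous_cos.
apply: (measurableT_comp (f := @sin R)); last exact: measurable_funM.
by apply: continuous_measurable_fun; exact: continuous_sin.
Qed.

Lemma circle_conjM (z : circle R) : (circle_val z)^* * z = 1.
Proof. by rewrite mulrC -normCK (eqP (circle_valP z)) expr1n. Qed.

(* Since [conj z = 1 / z] on the circle, [conj z ^ N * P z] is a general
   trigonometric polynomial. *)
Definition trig_poly (h : R -> R) : Prop := exists (N : nat) (P : {poly R[i]}),
  forall t, (h t)%:C = (circle_val (expi t))^* ^+ N * P.[expi t].

Lemma trig_poly_measurable h : trig_poly h -> measurable_fun setT h.
Proof.
move=> [N [P hE]].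
have [] : cmeasurable (fun t : measurableTypeR R => (h t)%:C).
  rewrite (_ : (fun _ => _) = fun t => (circle_val (expi t))^* ^+ N * P.[expi t]); last first.
    exact/funext.
  apply: cmeasurableM.
    by apply: cmeasurableX; apply: cmeasurable_conj; exact: cmeasurable_expi.
  exact/cmeasurable_horner/cmeasurable_expi.
by [].
Qed.

Lemma trig_poly_cst a : trig_poly (fun=> a).
Proof. by exists 0, (a%:C)%:P => t; rewrite hornerC expr0 mul1r. Qed.

Lemma trig_polyM g h : trig_poly g -> trig_poly h -> trig_poly (fun t => g t * h t).
Proof.
move=> [N [P gE]] [M [Q hE]]; exists (N + M), (P * Q) => t.
by rewrite hornerM rmorphM/= gE hE exprD mulrACA.
Qed.

Lemma trig_polyD g h : trig_poly g -> trig_poly h -> trig_poly (fun t => g t + h t).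
Proof.
move=> [N [P gE]] [M [Q hE]]; exists (N + M), ('X^M * P + 'X^N * Q) => t.
rewrite rmorphD/= gE hE !hornerE exprD.
have cz n : (circle_val (expi t))^* ^+ n * (circle_val (expi t)) ^+ n = 1.
  by rewrite -exprMn circle_conjM expr1n.
rewrite mulrDr; congr (_ + _).
  by rewrite -[LHS]mulr1 -(cz M); ring.
by rewrite -[LHS]mulr1 -(cz N); ring.
Qed.

Lemma trig_polyZ a h : trig_poly h -> trig_poly (fun t => a * h t).
Proof. by apply: trig_polyM; exact: trig_poly_cst. Qed.

Lemma trig_polyX h n : trig_poly h -> trig_poly (fun t => h t ^+ n).
Proof.
move=> th; elim: n => [|n IH]; first by under eq_fun do rewrite expr0; exact: trig_poly_cst.
by under eq_fun do rewrite exprS; exact: trig_polyM.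
Qed.

Lemma trig_poly_cos a : trig_poly (fun t => cos (2 * pi * t - a)).
Proof.
(* On the circle, [cos (theta - a)] is [conj z] times [(exp(-ia) z^2 + exp(ia)) / 2]. *)
exists 1%N, (((cos a -i* sin a) / 2)%:P * 'X * 'X + ((cos a +i* sin a) / 2)%:P) => t.
rewrite !hornerE expr1 [RHS]mulrDr.
have czz (c : R[i]) : (circle_val (expi t))^* * (c * expi t * expi t) = c * expi t.
  by rewrite -[RHS]mulr1 -(circle_conjM (expi t)); ring.
rewrite czz.
rewrite /Defs.expi/= cosB.
have -> : (2 : R[i])^-1 = (2^-1 : R)%:C by rewrite rmorphV ?unitfE ?pnatr_eq0//= rmorph_nat.
simpc; apply/eqP; rewrite eq_complex/=; apply/andP; by split; apply/eqP; field.
Qed.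

Lemma lebesgue_unit_interval_lty : (@lebesgue_measure R `[0%R, 1%R[ < +oo)%E.
Proof. by rewrite lebesgue_measure_itv/= lte_fin ltr01 -EFinB ltry. Qed.

(** Lebesgue measure of [[0, 1[] as a finite measure on the whole line, so that [l2_closure] applies
    to total functions while limits are checked on [[0, 1[] only. *)
Definition unit_interval_measure : {finite_measure set (measurableTypeR R) -> \bar R} :=
  @mfrestr _ (measurableTypeR R) R _ (@lebesgue_measure R) (@measurable_itv R `[0%R, 1%R[)
    lebesgue_unit_interval_lty.

Local Notation mu := unit_interval_measure.

Lemma ae_unit_interval (P : set R) : (forall t, 0 <= t < 1 -> P t) -> \forall t \ae mu, P t.
Proof.
move=> H.
exists (~` `[0, 1[); split.
- by apply: measurableC; exact: measurable_itv.
- by rewrite /= /mfrestr /mrestr setICl; exact: measure0.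
- by move=> t /= tN; rewrite in_itv/= => t01; apply: tN; exact: H.
Qed.

(** On the circle [[0, a]] becomes the closed arc centred at angle [pi a] with half-width [pi a], so
    one cosine inequality cuts out its complement. Indeed [cos (pi a) - cos (2 pi t - pi a)] equals
    [2 sin (pi t) sin (pi (t - a))]. *)
Lemma cos_lt_arc (a t : R) : 0 <= a < 1 -> 0 <= t < 1 ->
  (cos (2 * pi * t - pi * a) < cos (pi * a)) = (a < t).
Proof.
move=> /andP[a0 a1] /andP[t0 t1]; have pi0 := pi_gt0 R.
have -> : 2 * pi * t - pi * a = pi * t + pi * (t - a) by ring.
have -> : cos (pi * a) = cos (pi * t - pi * (t - a)) by congr cos; ring.
rewrite cosD cosB; apply/idP/idP => h.
  rewrite ltNge; apply/negP => ta.
  have s1 : 0 <= sin (pi * t) by apply: sin_ge0_pi; nra.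
  have s2 : 0 <= sin (pi * (a - t)) by apply: sin_ge0_pi; nra.
  have : sin (pi * (t - a)) = - sin (pi * (a - t)) by rewrite -sinN; congr sin; ring.
  nra.
have s1 : 0 < sin (pi * t) by apply: sin_gt0_pi; nra.
have s2 : 0 < sin (pi * (t - a)) by apply: sin_gt0_pi; nra.
have := mulr_gt0 s1 s2; lra.
Qed.

Lemma trig_poly_threshold n h : trig_poly h -> trig_poly (fun t => threshold n (h t)).
Proof.
move=> th; apply: trig_polyX; apply: trig_polyD; first exact: trig_poly_cst.
under eq_fun do rewrite -mulN1r.
by apply: trig_polyZ; exact: trig_polyX.
Qed.

Lemma l2_closure_ray a : l2_closure mu trig_poly \1_(`]a, +oo[).
Proof.
have m1 : measurable_fun setT (\1_(`]a, +oo[) : R -> R).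
  by apply: measurable_indic; exact: measurable_itv.
have i1 : mu.-integrable setT (fun x : measurableTypeR R => ((1:R) ^+ 2)%:E).
  by rewrite expr1n; exact: finite_measure_integrable_cst.
have b1 x : `|\1_(`]a, +oo[) x| <= 1 :> R.
  by rewrite indicE; case: (_ \in _); rewrite ?normr1 ?normr0.
have sub_closure := l2_closure_sub mu trig_poly_measurable.
have [a0|a0] := ltP a 0; last have [a1|a1] := leP 1 a.
- apply: (@l2_closure_dominated _ _ _ mu _ trig_poly_measurable _ (fun _ _ => 1) (fun=> 1)) => //.
  + by move=> n; apply: sub_closure; exact: trig_poly_cst.
  + apply: ae_unit_interval => t /andP[t0 _]; rewrite indicE mem_set.
      exact: cvg_cst.
    by rewrite /= in_itv/= andbT (lt_le_trans a0).
  + by move=> n x; rewrite normr1.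
- apply: (@l2_closure_dominated _ _ _ mu _ trig_poly_measurable _ (fun _ _ => 0) (fun=> 1)) => //.
  + by move=> n; apply: sub_closure; exact: trig_poly_cst.
  + apply: ae_unit_interval => t /andP[_ t1]; rewrite indicE memNset.
      exact: cvg_cst.
    by rewrite /= in_itv/= andbT => at1; have := lt_trans (le_lt_trans a1 at1) t1; rewrite ltxx.
  + by move=> n x; rewrite normr0.
(* The difference of two cosines lies in [-2, 2]; this rescaling brings it into [0, 1] and sends 0
   to the jump at 1/2. *)
pose y t := 2^-1 + 4^-1 * (cos (2 * pi * t - pi * a) + - cos (pi * a)).
have ty : trig_poly y.
  apply: trig_polyD; first exact: trig_poly_cst.
  apply: trig_polyZ.
  by apply: trig_polyD; [exact: trig_poly_cos|exact: trig_poly_cst].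
have y01 t : 0 <= y t <= 1.
  rewrite /y; have := cos_geN1 (2 * pi * t - pi * a); have := cos_le1 (2 * pi * t - pi * a).
  by have := cos_geN1 (pi * a); have := cos_le1 (pi * a); lra.
apply: (@l2_closure_dominated _ _ _ mu _ trig_poly_measurable _ (fun n t => threshold n (y t)) (fun=> 1)) => //.
- by move=> n; apply: sub_closure; exact: trig_poly_threshold.
- apply: ae_unit_interval => t t01.
  have := cvg_threshold (y01 t); have -> : (y t < 2^-1) = (a < t).
    by rewrite -(@cos_lt_arc a t) ?a0// /y; apply/idP/idP; lra.
  by rewrite indicE mem_setE in_itv/= andbT.
- by move=> n t; have := threshold_itv n (y01 t) => /andP[h0 h1]; rewrite ger0_norm.
Qed.

(** Open rays generate the Borel sets and are stable under intersection, so [l2_closure_ray] extends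
    to all Borel indicators and then to square integrable functions. *)
Lemma l2_closure_trig_poly (h : R -> R) : measurable_fun setT h ->
  mu.-integrable setT (fun t => (h t ^+ 2)%:E) -> l2_closure mu trig_poly h.
Proof.
apply: (@l2_closure_sqr_integrable _ (measurableTypeR R) R mu trig_poly
  trig_poly_measurable trig_polyD trig_polyZ trig_poly_cst).
apply: (@l2_closure_indic _ (measurableTypeR R) R mu trig_poly
  trig_poly_measurable trig_polyD trig_polyZ trig_poly_cst _
  (measurable_realfun.RGenOInfty.measurableE R)).
- move=> _ _ [x ->] [z ->]; exists (Num.max x z).
  by apply/seteqP; split => t /=; rewrite !in_itv/= !andbT gt_max => /andP.
- by move=> _ [x ->]; exact: l2_closure_ray.
Qed.

End trigonometric.
(** * The space L2 of the circle *)

Section circle_integral.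
Context {R : realType}.
Local Notation C := R[i].
Local Notation m := (@arc_measure R).
Implicit Types (f g h : circle R -> C) (c : C).

Definition cj f : circle R -> C := fun z => (f z)^*.

Lemma cjD f g : cj (f + g) = cj f + cj g.
Proof. by apply/funext => z; rewrite /cj !fctE rmorphD. Qed.

Lemma cjN f : cj (- f) = - cj f.
Proof. by apply/funext => z; rewrite /cj !fctE rmorphN. Qed.

Lemma cjM f g : cj (f * g) = cj f * cj g.
Proof. by apply/funext => z; rewrite /cj !fctE rmorphM. Qed.

Lemma cj_cst c : cj (cst c) = cst c^*.
Proof. by []. Qed.

Lemma cj1 : cj 1 = 1.
Proof. by apply/funext => z; rewrite /cj rmorph1. Qed.

Lemma cjK f : cj (cj f) = f.
Proof. by apply/funext => z; rewrite /cj conjCK. Qed.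

Definition cintegrable f : Prop :=
  m.-integrable setT (EFin \o (fun z => complex.Re (f z))) /\
  m.-integrable setT (EFin \o (fun z => complex.Im (f z))).

Lemma cintegral_add f g : cintegrable f -> cintegrable g ->
  cintegrable (f + g) /\ cintegral (f + g) = cintegral f + cintegral g.
Proof.
move=> [rf jf] [rg jg].
have ReD : (fun z => complex.Re ((f + g) z)) =
    (fun z => complex.Re (f z) + complex.Re (g z)).
  by apply/funext => z; rewrite fctE raddfD.
have ImD : (fun z => complex.Im ((f + g) z)) =
    (fun z => complex.Im (f z) + complex.Im (g z)).
  by apply/funext => z; rewrite fctE raddfD.
rewrite /cintegrable /cintegral ReD ImD; split.
  by split; rewrite /comp; under eq_fun do rewrite EFinD; exact: integrableD.
by rewrite !RintegralD.
Qed.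

Lemma cintegral_scale c f : cintegrable f ->
  cintegrable (cst c * f) /\ cintegral (cst c * f) = c * cintegral f.
Proof.
move: c => [a b] [rf jf].
have ReM : (fun z => complex.Re ((cst (a +i* b) * f) z)) =
    (fun z => a * complex.Re (f z) - b * complex.Im (f z)).
  by apply/funext => z; rewrite !fctE; case: (f z).
have ImM : (fun z => complex.Im ((cst (a +i* b) * f) z)) =
    (fun z => a * complex.Im (f z) + b * complex.Re (f z)).
  by apply/funext => z; rewrite !fctE; case: (f z).
have iZ (k : R) (h : circle R -> R) : m.-integrable setT (EFin \o h) ->
    m.-integrable setT (EFin \o (fun z => k * h z)).
  by move=> ih; rewrite /comp; under eq_fun do rewrite EFinM; exact: integrableZl.
rewrite /cintegrable /cintegral ReM ImM; split.
  split; rewrite /comp.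
    by under eq_fun do rewrite EFinB; apply: integrableB => //; exact: iZ.
  by under eq_fun do rewrite EFinD; apply: integrableD => //; exact: iZ.
rewrite RintegralB ?RintegralD//; try exact: iZ.
by rewrite !RintegralZl//; apply/eqP; rewrite eq_complex/= eqxx/=.
Qed.

Lemma cintegral_conj f : cintegrable f ->
  cintegrable (cj f) /\ cintegral (cj f) = (cintegral f)^*.
Proof.
move=> [rf jf].
have ReC : (fun z => complex.Re (cj f z)) = (fun z => complex.Re (f z)).
  by apply/funext => z; rewrite /cj; case: (f z).
have ImC : (fun z => complex.Im (cj f z)) = (fun z => (-1) * complex.Im (f z)).
  by apply/funext => z; rewrite /cj; case: (f z) => x y /=; rewrite mulN1r.
rewrite /cintegrable /cintegral ReC ImC; split.
  split => //; rewrite /comp; under eq_fun do rewrite EFinM; exact: integrableZl.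
by rewrite RintegralZl// mulN1r.
Qed.

Lemma ae_eq_cintegral f g : cmeasurable f -> cmeasurable g ->
  (\forall z \ae m, f z = g z) -> cintegral f = cintegral g.
Proof.
move=> [rf jf] [rg jg] fg; rewrite /cintegral; congr (fine _ +i* fine _).
  apply: ae_eq_integral => //; try exact/measurable_EFinP.
  by apply: filterS fg => z -> _.
apply: ae_eq_integral => //; try exact/measurable_EFinP.
by apply: filterS fg => z -> _.
Qed.

Lemma Lfun2P (h : circle R -> R) : h \in Lfun m 2%:E <->
  measurable_fun setT h /\ m.-integrable setT (fun z => (h z ^+ 2)%:E).
Proof.
split=> [hL|[mh ih]].
  split; last exact: Lfun2_integrable_sqr.
  by move: hL; rewrite inE => /andP[/[!inE]].
rewrite inE; apply/andP; split; rewrite inE//=.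
rewrite /finite_norm unlock /Lnorm poweR_lty//.
under eq_integral => x _ do rewrite /= powR_mulrn// real_normK ?num_real//.
exact: integrable_lty.
Qed.

(** Squared modulus with values in [R], so that norm estimates stay real and need no square root. *)
Definition sqn c : R := complex.Re (c * c^*).

Lemma sqnE c : sqn c = complex.Re c ^+ 2 + complex.Im c ^+ 2.
Proof. by case: c => a b; rewrite /sqn/= mulrN opprK !expr2. Qed.

Lemma sqn_ge0 c : 0 <= sqn c.
Proof. by rewrite sqnE addr_ge0// sqr_ge0. Qed.

Lemma sqnM c c' : sqn (c * c') = sqn c * sqn c'.
Proof. by case: c => a b; case: c' => a' b'; rewrite !sqnE/=; ring. Qed.

Lemma sqn_eq0 c : sqn c = 0 -> c = 0.
Proof.
rewrite sqnE; case: c => a b /= /eqP; rewrite paddr_eq0 ?sqr_ge0// !sqrf_eq0.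
by move=> /andP[/eqP -> /eqP ->].
Qed.

Lemma L2P f : L2 f <-> cmeasurable f /\ m.-integrable setT (fun z => (sqn (f z))%:E).
Proof.
rewrite /L2 !Lfun2P; split=> [[[rf irf] [jf ijf]]|[[rf jf] isf]].
  split => //; under eq_fun do rewrite sqnE EFinD; exact: integrableD.
split; split=> //; apply: (le_integrable _ _ _ isf) => //.
- by apply/measurable_EFinP; exact: measurable_funX.
- move=> z _; rewrite /= lee_fin ger0_norm ?sqr_ge0// ger0_norm ?sqn_ge0//.
  by rewrite sqnE lerDl sqr_ge0.
- by apply/measurable_EFinP; exact: measurable_funX.
- move=> z _; rewrite /= lee_fin ger0_norm ?sqr_ge0// ger0_norm ?sqn_ge0//.
  by rewrite sqnE lerDr sqr_ge0.
Qed.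

Lemma L2_cmeasurable f : L2 f -> cmeasurable f.
Proof. by move=> /L2P[]. Qed.

Lemma L2M_integrable f g : L2 f -> L2 g -> cintegrable (f * g).
Proof.
move=> [rf jf] [rg jg].
have H (h k : circle R -> R) : h \in Lfun m 2%:E -> k \in Lfun m 2%:E ->
    m.-integrable setT (EFin \o (fun z => h z * k z)).
  by move=> hL kL; apply/Lfun1_integrable; exact: Lfun2_mul_Lfun1.
split.
  rewrite (_ : _ \o _ = fun z => ((complex.Re (f z) * complex.Re (g z))%:E -
     (complex.Im (f z) * complex.Im (g z))%:E)%E); last first.
    by apply/funext => z; rewrite /= fctE -EFinB; case: (f z) => a b; case: (g z).
  by apply: integrableB => //; exact: H.
rewrite (_ : _ \o _ = fun z => ((complex.Re (f z) * complex.Im (g z))%:E +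
   (complex.Im (f z) * complex.Re (g z))%:E)%E); last first.
  by apply/funext => z; rewrite /= fctE -EFinD; case: (f z) => a b; case: (g z).
by apply: integrableD => //; exact: H.
Qed.

Lemma sqn_conj c : sqn (c^*) = sqn c.
Proof. by rewrite /sqn conjCK mulrC. Qed.

Lemma L2_cj f : L2 f -> L2 (cj f).
Proof.
move=> /L2P[mf sf]; apply/L2P; split; first exact: cmeasurable_conj.
by under eq_fun do rewrite sqn_conj.
Qed.

Lemma sqn_leD c c' : sqn (c + c') <= 2 * sqn c + 2 * sqn c'.
Proof.
rewrite !sqnE; case: c => a b; case: c' => a' b' /=.
have := sqr_ge0 (a - a'); have := sqr_ge0 (b - b'); nra.
Qed.

Lemma cmeasurable_sqn f : cmeasurable f ->
  measurable_fun setT (fun z => (sqn (f z))%:E : \bar R).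
Proof.
move=> [rf jf]; apply/measurable_EFinP; under eq_fun do rewrite sqnE.
by apply: measurable_funD; exact: measurable_funX.
Qed.

Lemma L2D f g : L2 f -> L2 g -> L2 (f + g).
Proof.
move=> /L2P[mf sf] /L2P[mg sg]; apply/L2P; split; first exact: cmeasurableD.
have i2 : m.-integrable setT (fun z => 2%:E * (sqn (f z))%:E + 2%:E * (sqn (g z))%:E)%E.
  by apply: integrableD => //; exact: integrableZl.
apply: (le_integrable _ _ _ i2) => //; first by apply: cmeasurable_sqn; exact: cmeasurableD.
move=> z _; rewrite -!EFinM -EFinD /= lee_fin ger0_norm ?sqn_ge0// ger0_norm.
  exact: sqn_leD.
by rewrite addr_ge0// mulr_ge0// sqn_ge0.
Qed.

(** Measurability is recorded separately because [ess_bounded] does not imply it, and products with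
    [L2] functions require it. *)
Definition bounded_symbol f : Prop := cmeasurable f /\ ess_bounded f.

Lemma le_normC_sqn c (M : R) : 0 <= M -> `|c| <= M%:C -> sqn c <= M ^+ 2.
Proof.
move=> M0; rewrite normc_def lecR -sqnE => h.
by rewrite -(sqr_sqrtr (sqn_ge0 c)) lerXn2r// nnegrE sqrtr_ge0.
Qed.

Lemma L2M_bounded f g : bounded_symbol f -> L2 g -> L2 (f * g).
Proof.
move=> [mf [M fM]] /L2P[mg sg]; apply/L2P; split; first exact: cmeasurableM.
have mfg := cmeasurable_sqn (cmeasurableM mf mg).
apply/integrableP; split => //.
have := integrableZl measurableT (M ^+ 2) sg => /integrableP[mMg].
apply: le_lt_trans; apply: ae_ge0_le_integral => //.
- exact: measurableT_comp.
- exact: measurableT_comp.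
- apply: filterS fM => z fM _; rewrite -EFinM /= lee_fin ger0_norm ?sqn_ge0//.
  rewrite (ger0_norm (mulr_ge0 (sqr_ge0 M) (sqn_ge0 _))) sqnM ler_wpM2r ?sqn_ge0//.
  apply: le_normC_sqn => //; rewrite -ler0c; exact: le_trans fM.
Qed.

End circle_integral.

(** * The inner product and the Cauchy-Schwarz inequality *)

Section inner_product.
Context {R : realType}.
Local Notation C := R[i].
Local Notation m := (@arc_measure R).
Implicit Types (f g h : circle R -> C) (c : C).

Lemma innerE f g : inner f g = cintegral (f * cj g).
Proof. by []. Qed.

Lemma innerMl h f g : inner (h * f) g = inner f (cj h * g).
Proof. by rewrite !innerE cjM cjK; congr cintegral; ring. Qed.

Lemma inner_cj f g : inner (cj f) (cj g) = inner g f.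
Proof. by rewrite !innerE cjK mulrC. Qed.

Lemma L2_int f g : L2 f -> L2 g -> cintegrable (f * cj g).
Proof. by move=> lf lg; apply: L2M_integrable => //; exact: L2_cj. Qed.

Lemma innerDl f g h : L2 f -> L2 g -> L2 h -> inner (f + g) h = inner f h + inner g h.
Proof.
move=> lf lg lh; rewrite !innerE mulrDl.
by have [] := cintegral_add (L2_int lf lh) (L2_int lg lh).
Qed.

Lemma innerDr f g h : L2 f -> L2 g -> L2 h -> inner h (f + g) = inner h f + inner h g.
Proof.
move=> lf lg lh; rewrite !innerE cjD mulrDr.
by have [] := cintegral_add (L2_int lh lf) (L2_int lh lg).
Qed.

Lemma innerZl c f g : L2 f -> L2 g -> inner (cst c * f) g = c * inner f g.
Proof.
move=> lf lg; rewrite !innerE -mulrA.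
by have [] := cintegral_scale c (L2_int lf lg).
Qed.

Lemma innerZr c f g : L2 f -> L2 g -> inner f (cst c * g) = c^* * inner f g.
Proof.
move=> lf lg; rewrite !innerE cjM cj_cst mulrCA.
by have [] := cintegral_scale c^* (L2_int lf lg).
Qed.

Lemma innerC f g : L2 f -> L2 g -> (inner f g)^* = inner g f.
Proof.
move=> lf lg; rewrite !innerE.
have [_ <-] := cintegral_conj (L2_int lf lg).
by rewrite cjM cjK mulrC.
Qed.

Lemma bounded_symbolM f g : bounded_symbol f -> bounded_symbol g -> bounded_symbol (f * g).
Proof.
move=> [mf [M Mf]] [mg [N Ng]]; split; first exact: cmeasurableM.
exists (M * N); apply: filterS2 Mf Ng => z Mz Nz.
by rewrite !fctE normrM rmorphM/= ler_pM.
Qed.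

Lemma bounded_symbolD f g : bounded_symbol f -> bounded_symbol g -> bounded_symbol (f + g).
Proof.
move=> [mf [M Mf]] [mg [N Ng]]; split; first exact: cmeasurableD.
exists (M + N); apply: filterS2 Mf Ng => z Mz Nz.
by rewrite !fctE (le_trans (ler_normD _ _))// rmorphD/= lerD.
Qed.

Lemma bounded_symbol_cst c : bounded_symbol (cst c : circle R -> C).
Proof.
split; first exact: cmeasurable_cst.
by exists (complex.Re `|c|); apply: aeW => z; rewrite (RRe_real (normr_real _)).
Qed.

Lemma bounded_symbol1 : bounded_symbol (1 : circle R -> C).
Proof. exact: (bounded_symbol_cst 1). Qed.

Lemma bounded_symbol_cj f : bounded_symbol f -> bounded_symbol (cj f).
Proof.
move=> [mf [M Mf]]; split; first exact: cmeasurable_conj.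
by exists M; apply: filterS Mf => z; rewrite /cj norm_conjC.
Qed.

Lemma bounded_symbolX f n : bounded_symbol f -> bounded_symbol (f ^+ n).
Proof.
move=> bf; elim: n => [|n IH]; first by rewrite expr0; exact: bounded_symbol1.
by rewrite exprS; exact: bounded_symbolM.
Qed.

Lemma L2_cst c : L2 (cst c : circle R -> C).
Proof. by split; exact: Lfun_cst. Qed.

Lemma L2_1 : L2 (1 : circle R -> C). Proof. exact: (L2_cst 1). Qed.

Lemma bounded_symbol_L2 f : bounded_symbol f -> L2 f.
Proof. by move=> bf; rewrite -[f]mulr1; apply: L2M_bounded => //; exact: L2_1. Qed.

Lemma L2Z c f : L2 f -> L2 (cst c * f).
Proof. by apply: L2M_bounded; exact: bounded_symbol_cst. Qed.

Lemma L2N f : L2 f -> L2 (- f).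
Proof.
move=> lf; have -> : - f = cst (-1) * f by apply/funext => z; rewrite !fctE mulN1r.
exact: L2Z.
Qed.

Lemma innerNl f g : L2 f -> L2 g -> inner (- f) g = - inner f g.
Proof.
move=> lf lg; have -> : - f = cst (-1) * f by apply/funext => z; rewrite !fctE mulN1r.
by rewrite innerZl// mulN1r.
Qed.

Lemma innerNr f g : L2 f -> L2 g -> inner g (- f) = - inner g f.
Proof.
move=> lf lg; have -> : - f = cst (-1) * f by apply/funext => z; rewrite !fctE mulN1r.
by rewrite innerZr// rmorphN1 mulN1r.
Qed.

Definition Z : circle R -> C := @circle_val R.

Lemma cjZZ : cj Z * Z = 1.
Proof. by apply/funext => z; exact: circle_conjM. Qed.

(** The sigma-algebra of the circle is by construction the final one for [expi], so preimages can be
    tested on the line. *)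
Lemma measurable_circle (h : circle R -> R) :
  measurable_fun setT (fun t : measurableTypeR R => h (expi t)) -> measurable_fun setT h.
Proof. by move=> mh _ B mB; have := mh measurableT B mB; rewrite !setTI. Qed.

Lemma bounded_symbolZ : bounded_symbol Z.
Proof.
split.
  by split; apply: measurable_circle; have [] := @cmeasurable_expi R.
by exists 1; apply: aeW => z; rewrite (eqP (circle_valP z)).
Qed.

Definition nsq f : R := complex.Re (inner f f).

Lemma nsqE f : L2 f -> (nsq f)%:E = (\int[m]_z (sqn (f z))%:E)%E.
Proof.
move=> /L2P[mf sf]; rewrite /nsq /inner /cintegral /= /Rintegral fineK//.
exact: integrable_fin_num.
Qed.

Lemma inner_nsq f : L2 f -> inner f f = (nsq f)%:C.
Proof.
move=> lf; have := innerC lf lf; rewrite /nsq; case: (inner f f) => a b [] h.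
by apply/eqP; rewrite eq_complex/= eqxx/=; apply/eqP; lra.
Qed.

Lemma nsq_ge0 f : L2 f -> 0 <= nsq f.
Proof.
by move=> lf; rewrite -lee_fin nsqE//; apply: integral_ge0 => z _; rewrite lee_fin sqn_ge0.
Qed.

Lemma nsq_eq0 f : L2 f -> nsq f = 0 -> \forall z \ae m, f z = 0.
Proof.
move=> lf; have /L2P[mf sf] := lf => f0.
have : (\int[m]_z `|(sqn (f z))%:E| = 0)%E.
  rewrite -[RHS]/(0%:E) -f0 nsqE//; apply: eq_integral => z _.
  by rewrite gee0_abs// lee_fin sqn_ge0.
move/(ae_eq_integral_abs _ measurableT (cmeasurable_sqn mf)).
by apply: filterS => z /(_ I)[]; exact: sqn_eq0.
Qed.

Lemma ae_eq_inner f f' g g' : L2 f -> L2 f' -> L2 g -> L2 g' ->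
  (\forall z \ae m, f z = f' z) -> (\forall z \ae m, g z = g' z) ->
  inner f g = inner f' g'.
Proof.
move=> lf lf' lg lg' ff gg; apply: ae_eq_cintegral.
- by apply: cmeasurableM; [exact: L2_cmeasurable|apply: L2_cmeasurable; exact: L2_cj].
- by apply: cmeasurableM; [exact: L2_cmeasurable|apply: L2_cmeasurable; exact: L2_cj].
- by apply: filterS2 ff gg => z -> ->.
Qed.

Lemma nsqD f g : L2 f -> L2 g ->
  nsq (f + g) = nsq f + nsq g + 2 * complex.Re (inner f g).
Proof.
move=> lf lg; have lfg := L2D lf lg.
rewrite /nsq innerDl// !innerDr// -(innerC lf lg) !raddfD/=.
by case: (inner f g) => a b /=; ring.
Qed.

Lemma nsqZ c f : L2 f -> nsq (cst c * f) = sqn c * nsq f.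
Proof.
move=> lf; have lcf := L2Z c lf; rewrite /nsq innerZl// innerZr//.
rewrite inner_nsq//= sqnE; case: c {lcf} => a b /=; ring.
Qed.

(** The squared norm of [nsq g * f - inner f g * g] is nonnegative and equals [nsq g] times the
    desired gap. If [nsq g = 0], then [g] vanishes almost everywhere. *)
Lemma cauchy_schwarz f g : L2 f -> L2 g -> sqn (inner f g) <= nsq f * nsq g.
Proof.
move=> lf lg; have g0 := nsq_ge0 lg; have [ng|ng] := eqVneq (nsq g) 0.
  have -> : inner f g = inner f (cst 0 * g).
    apply: ae_eq_inner => //; first exact: L2Z.
      exact: aeW.
    by apply: filterS (nsq_eq0 lg ng) => z ->; rewrite !fctE mul0r.
  by rewrite innerZr// rmorph0 mul0r sqnE expr0n addr0 ng mulr0.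
have gpos : 0 < nsq g by rewrite lt_neqAle eq_sym ng.
have := nsq_ge0 (L2D (L2Z (nsq g)%:C lf) (L2Z (- inner f g) lg)).
rewrite nsqD ?nsqZ//; try exact: L2Z.
rewrite innerZl//; last exact: L2Z.
rewrite innerZr// => h.
rewrite -subr_ge0 -(pmulr_rge0 _ gpos); apply: le_trans h _.
rewrite !sqnE; case: (inner f g) => a b /=; rewrite le_eqVlt; apply/orP; left; apply/eqP; ring.
Qed.

(** How the density arguments below end: [e] is the squared approximation error, and [K] comes from
    Cauchy-Schwarz. *)
Lemma sqn_small c (K : R) : (forall e, 0 < e -> sqn c <= e * K) -> c = 0.
Proof.
move=> H; apply: sqn_eq0; apply/eqP; rewrite eq_le sqn_ge0 andbT; apply/ler_addgt0Pr => e e0.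
have K0 : 0 < `|K| + 1 by rewrite ltr_wpDl.
have := H _ (divr_gt0 e0 K0); move/le_trans; apply; rewrite add0r.
rewrite mulrAC ler_pdivrMr//; apply: ler_wpM2l; first exact: ltW.
by apply: (le_trans (ler_norm _)); rewrite lerDl.
Qed.

End inner_product.

(** * Integrals of powers of z *)

Section moments.
Context {R : realType}.
Local Notation C := R[i].
Local Notation m := (@arc_measure R).

Lemma expiX (t : R) n : circle_val (expi t) ^+ n =
  cos (2 * pi * n%:R * t) +i* sin (2 * pi * n%:R * t).
Proof.
elim: n => [|n IH]; first by rewrite expr0 mulr0 mul0r cos0 sin0.
have -> : 2 * pi * n.+1%:R * t = 2 * pi * n%:R * t + 2 * pi * t.
  by rewrite -natr1; ring.
rewrite exprSr IH cosD sinD /Defs.expi /=; simpc.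
by apply/eqP; rewrite eq_complex /=; apply/andP; split; apply/eqP; ring.
Qed.

(** The endpoint 1, absent from the parametrisation of the circle, is added back so that the
    fundamental theorem of calculus applies on a closed interval. *)
Lemma integral_circle (g : circle R -> R) (h : R -> R) :
  continuous h -> (forall t, `|h t| <= 1) -> (forall t, g (expi t) = h t) ->
  (\int[m]_z (g z)%:E = \int[lebesgue_measure]_(t in `[0%R, 1%R]) (h t)%:E)%E.
Proof.
move=> ch bh gh.
have mh : measurable_fun [set: measurableTypeR R] h by exact: continuous_measurable_fun.
have mg : measurable_fun setT g.
  by apply: measurable_circle; under eq_fun do rewrite gh.
have hE : (EFin \o g) \o @expi R = EFin \o h by apply/funext => t /=; rewrite gh.
have ih : unit_interval_measure.-integrable [set: measurableTypeR R] (EFin \o h).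
  apply: measurable_bounded_integrable => //.
    by rewrite -ge0_fin_numE// fin_num_measure.
  by exists 1; split => // x x1 t _; apply: (le_trans (bh t)); exact: ltW.
rewrite [LHS](@integral_pushforward _ _ (measurableTypeR R) (circle R) R (@expi R)
  (@measurable_expi R) unit_interval_measure setT (EFin \o g)) //; first last.
- by rewrite hE preimage_setT.
- exact/measurable_EFinP.
rewrite hE preimage_setT.
have mI : measurable (~` `[0%R, 1%R[ : set (measurableTypeR R)).
  by apply: measurableC; exact: measurable_itv.
rewrite (negligible_integral mI)//; last first.
  by rewrite /= /mfrestr /mrestr setICl; exact: measure0.
rewrite setTD setCK.
rewrite (eq_measure_integral (@lebesgue_measure R : {measure set (measurableTypeR R) -> \bar R})); last first.
  by move=> A mA A01; rewrite /= /mfrestr /mrestr setIidl.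
rewrite (@integral_itv_bndo_bndc R)//.
apply/measurable_EFinP; exact: (measurable_funS measurableT).
Qed.

Lemma cintegral_ZX n : cintegral (Z ^+ n.+1 : circle R -> C) = 0.
Proof.
pose k : R := 2 * pi * n.+1%:R.
have k0 : k != 0 by rewrite !mulf_neq0 ?pnatr_eq0// gt_eqF// pi_gt0.
have ck : continuous (fun t : R => k * t) by move=> t; apply: cvgMr; exact: cvg_id.
(* Periodicity is read off from [expi 1 = 1] raised to the power [n + 1]. *)
have [ckk sk] : cos k = 1 /\ sin k = 0.
  have := expiX 1 n.+1; rewrite mulr1 -/k.
  have -> : circle_val (expi (1 : R)) = 1.
    by rewrite /Defs.expi /= mulr1 mulr_natl cos2pi sin2pi.
  by rewrite expr1n => -[-> ->].
rewrite /cintegral /Rintegral.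
rewrite (@integral_circle _ (fun t => cos (k * t))); first last.
- by move=> t; rewrite exprfctE /Z expiX.
- by move=> t; rewrite ler_norml cos_geN1 cos_le1.
- by move=> t; apply: continuous_comp; [exact: ck|exact: continuous_cos].
rewrite (@integral_circle _ (fun t => sin (k * t))); first last.
- by move=> t; rewrite exprfctE /Z expiX.
- by move=> t; rewrite ler_norml sin_geN1 sin_le1.
- by move=> t; apply: continuous_comp; [exact: ck|exact: continuous_sin].
have dsin (x : R) : is_derive x (1 : R) (fun t : R => k^-1 * sin (k * t)) (cos (k * x)).
  have dk : is_derive x (1 : R) (fun t : R => k * t) k.
    by apply: is_derive_eq; rewrite /GRing.scale/= mulr1.
  have := is_deriveZ k^-1 (is_derive1_comp (is_derive_sin (k * x)) dk).
  by rewrite (_ : _ *: _ = cos (k * x)) // /GRing.scale/= mulrCA mulVf// mulr1.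
have dcos (x : R) : is_derive x (1 : R) (fun t : R => - k^-1 * cos (k * t)) (sin (k * x)).
  have dk : is_derive x (1 : R) (fun t : R => k * t) k.
    by apply: is_derive_eq; rewrite /GRing.scale/= mulr1.
  have := is_deriveZ (- k^-1) (is_derive1_comp (is_derive_cos (k * x)) dk).
  by rewrite (_ : _ *: _ = sin (k * x)) // /GRing.scale/= mulNr mulNr mulrN opprK mulrCA mulVf// mulr1.
have FTC (f F : R -> R) : continuous f -> (forall x : R, is_derive x (1 : R) F (f x)) ->
    (\int[lebesgue_measure]_(t in `[0%R, 1%R]) (f t)%:E = (F 1)%:E - (F 0)%:E)%E.
  move=> cf dF; have cF : continuous F.
    by move=> x; apply: differentiable_continuous; apply/derivable1_diffP; exact: ex_derive.
  apply: continuous_FTC2 => //.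
  - by apply: continuous_subspaceT.
  - split; first by move=> x _; exact: ex_derive.
    + by apply: cvg_at_right_filter; exact: cF.
    + by apply: cvg_at_left_filter; exact: cF.
  - by move=> x _; rewrite derive1E; exact: derive_val.
rewrite (FTC _ _ _ dsin); last first.
  by move=> t; apply: continuous_comp; [exact: ck|exact: continuous_cos].
rewrite (FTC _ _ _ dcos); last first.
  by move=> t; apply: continuous_comp; [exact: ck|exact: continuous_sin].
by rewrite /= !mulr1 !mulr0 ckk sk sin0 cos0 !mulr0 !subrr.
Qed.

End moments.

(** * Transfer of the density from the interval to the circle *)

Section trigonometric_density.
Context {R : realType}.
Local Notation C := R[i].
Local Notation m := (@arc_measure R).
Local Notation mu := (@unit_interval_measure R).
Implicit Types (f g h : circle R -> C) (c : C) (P Q : {poly C}).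

Definition pz P : circle R -> C := fun z => P.[circle_val z].

Lemma pzD P Q : pz (P + Q) = pz P + pz Q.
Proof. by apply/funext => z; rewrite /pz hornerD. Qed.

Lemma pzM P Q : pz (P * Q) = pz P * pz Q.
Proof. by apply/funext => z; rewrite /pz hornerM. Qed.

Lemma pzC c : pz c%:P = cst c.
Proof. by apply/funext => z; rewrite /pz hornerC. Qed.

Lemma pzX : pz 'X = Z.
Proof. by apply/funext => z; rewrite /pz hornerX. Qed.

Lemma pzXn n : pz 'X^n = Z ^+ n.
Proof. by apply/funext => z; rewrite /pz hornerXn exprfctE. Qed.

Lemma bounded_symbol_pz P : bounded_symbol (pz P).
Proof.
elim/poly_ind: P => [|P c IH]; first by rewrite (pzC 0); exact: bounded_symbol_cst.
rewrite pzD pzM pzX pzC; apply: bounded_symbolD; last exact: bounded_symbol_cst.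
by apply: bounded_symbolM => //; exact: bounded_symbolZ.
Qed.

Lemma ge0_integral_circle (g : circle R -> R) : measurable_fun setT g ->
  (forall z, 0 <= g z) -> (\int[m]_z (g z)%:E = \int[mu]_t (g (expi t))%:E)%E.
Proof.
move=> mg g0.
rewrite [LHS](@ge0_integral_pushforward _ _ (measurableTypeR R) (circle R) R (@expi R)
  (@measurable_expi R) mu setT (EFin \o g)) ?preimage_setT//.
- exact/measurable_EFinP.
- by move=> z _; rewrite lee_fin.
Qed.

(** Real and imaginary parts are pulled back to the interval and approximated there, each within
    [e / 2] in squared distance; the two results combine over the common factor
    [conj z ^ (N + M)]. *)
Lemma L2_trig_dense f (e : R) : L2 f -> 0 < e ->
  exists N P, nsq (f - cj Z ^+ N * pz P) < e.
Proof.
move=> lf e0; have [[mf1 mf2] [/Lfun2P[_ sf1] /Lfun2P[_ sf2]]] := (L2_cmeasurable lf, lf).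
have line (g : circle R -> R) : measurable_fun setT g ->
    m.-integrable setT (fun z => (g z ^+ 2)%:E) ->
    exists2 t, trig_poly t & (l2dist mu (fun t => g (expi t)) t < (e / 2)%:E)%E.
  move=> mg ig; have mgl : measurable_fun setT (fun t : measurableTypeR R => g (expi t)).
    exact: measurableT_comp mg (@measurable_expi R).
  have [|_] := l2_closure_trig_poly mgl; last by apply; lra.
  apply/integrableP; split; first by apply/measurable_EFinP; exact: measurable_funX.
  move/integrableP : ig => [_].
  rewrite (_ : (\int[m]_z _)%E = (\int[m]_z (g z ^+ 2)%:E)%E); last first.
    by apply: eq_integral => z _; rewrite gee0_abs// lee_fin sqr_ge0.
  rewrite (@ge0_integral_circle (fun z => g z ^+ 2)); first last.
  - by move=> z; exact: sqr_ge0.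
  - exact: measurable_funX.
  apply: le_lt_trans; rewrite le_eqVlt; apply/orP; left; apply/eqP.
  by apply: eq_integral => t _; rewrite gee0_abs// lee_fin sqr_ge0.
have [t1 /[dup] tt1 [N [P t1E]] d1] := line _ mf1 sf1.
have [t2 /[dup] tt2 [M [Q t2E]] d2] := line _ mf2 sf2.
exists (N + M), ('X^M * P + 'X^N * ((0 +i* 1)%:P * Q)).
set T := _ * pz _.
have TE t : T (expi t) = t1 t +i* t2 t.
  have -> : t1 t +i* t2 t = (t1 t)%:C + (0 +i* 1) * (t2 t)%:C by simpc.
  rewrite t1E t2E /T pzD !pzM !pzXn pzC.
  rewrite !(mulrfctE, addrfctE, exprfctE) /cj /Z /pz.
  have cz n : (circle_val (expi t))^* ^+ n * (circle_val (expi t)) ^+ n = 1.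
    by rewrite -exprMn circle_conjM expr1n.
  rewrite exprD mulrDr; congr (_ + _).
    by rewrite -[RHS]mulr1 -(cz M); ring.
  by rewrite -[RHS]mulr1 -(cz N) /cst; ring.
have lT : L2 T.
  apply: bounded_symbol_L2; apply: bounded_symbolM; last exact: bounded_symbol_pz.
  by apply: bounded_symbolX; apply: bounded_symbol_cj; exact: bounded_symbolZ.
have lfT : L2 (f - T) by apply: L2D => //; exact: L2N.
rewrite -lte_fin nsqE// ge0_integral_circle; first last.
- by move=> z; exact: sqn_ge0.
- by have /cmeasurable_sqn/measurable_EFinP := L2_cmeasurable lfT.
have mdist (g : circle R -> R) t : measurable_fun setT g -> trig_poly t ->
    measurable_fun [set: measurableTypeR R] (fun x => ((g (expi x) - t x) ^+ 2 : R)%:E).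
  move=> mg tt; apply/measurable_EFinP; apply: measurable_funX; apply: measurable_funB.
    exact: measurableT_comp mg (@measurable_expi R).
  exact: trig_poly_measurable.
have -> : (e%:E = (e / 2)%:E + (e / 2)%:E)%E by rewrite -EFinD; congr EFin; field.
apply: le_lt_trans (lteD d1 d2).
rewrite /l2dist -ge0_integralD//; first last.
- exact: (mdist _ t2 mf2 tt2).
- by move=> t _; rewrite lee_fin sqr_ge0.
- exact: (mdist _ t1 mf1 tt1).
- by move=> t _; rewrite lee_fin sqr_ge0.
rewrite le_eqVlt; apply/orP; left; apply/eqP; apply: eq_integral => t _.
rewrite -EFinD; congr EFin; rewrite sqnE addrfctE opprfctE TE.
by case: (f (expi t)).
Qed.

End trigonometric_density.
(** * The Hardy space *)

Section hardy_space.
Context {R : realType}.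
Local Notation C := R[i].
Local Notation m := (@arc_measure R).
Implicit Types (f g h : circle R -> C) (c : C) (P Q : {poly C}).

Lemma L2Z_mul f : L2 f -> L2 (Z * f).
Proof. by apply: L2M_bounded; exact: bounded_symbolZ. Qed.

Lemma bounded_symbol_cjZ : bounded_symbol (cj Z : circle R -> C).
Proof. by apply: bounded_symbol_cj; exact: bounded_symbolZ. Qed.

Lemma L2cjZ_mul f : L2 f -> L2 (cj Z * f).
Proof. by apply: L2M_bounded; exact: bounded_symbol_cjZ. Qed.

Lemma L2_cjZX n : L2 (cj Z ^+ n : circle R -> C).
Proof. by apply: bounded_symbol_L2; apply: bounded_symbolX; exact: bounded_symbol_cjZ. Qed.

Lemma L2B f g : L2 f -> L2 g -> L2 (f - g).
Proof. by move=> lf lg; apply: L2D => //; exact: L2N. Qed.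

Lemma innerBl f g h : L2 f -> L2 g -> L2 h -> inner (f - g) h = inner f h - inner g h.
Proof. by move=> lf lg lh; rewrite innerDl ?innerNl//; exact: L2N. Qed.

Lemma innerBr f g h : L2 f -> L2 g -> L2 h -> inner h (f - g) = inner h f - inner h g.
Proof. by move=> lf lg lh; rewrite innerDr ?innerNr//; exact: L2N. Qed.

Lemma circle_val_neq0 (z : circle R) : circle_val z != 0.
Proof. by rewrite -normr_gt0 (eqP (circle_valP z)). Qed.

Lemma fourierN f n : fourier f (- (n%:Z)) = inner f (cj Z ^+ n).
Proof.
congr inner; apply/funext => z; rewrite exprfctE /cj /Z -invr_expz.
by rewrite -exprnP -exprVn; congr (_ ^+ n); rewrite -[LHS]mul1r -(circle_conjM z) mulfK// circle_val_neq0.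
Qed.

(** Reindexes negative frequencies by naturals, so that multiplication by [z] or [conj z] moves the
    index by one. *)
Lemma H2P f : H2 f <-> L2 f /\ forall n : nat, inner f (cj Z ^+ n.+1) = 0.
Proof.
split=> -[lf fn]; split=> // n.
  by rewrite -fourierN; apply: fn; rewrite oppr_lt0.
by case: n => // n _; rewrite NegzE fourierN.
Qed.

Lemma H2_L2 f : H2 f -> L2 f. Proof. by case. Qed.

Lemma H2D f g : H2 f -> H2 g -> H2 (f + g).
Proof.
move=> /H2P[lf hf] /H2P[lg hg]; apply/H2P; split; first exact: L2D.
by move=> n; rewrite innerDl ?hf ?hg ?addr0//; exact: L2_cjZX.
Qed.

Lemma H2Z c f : H2 f -> H2 (cst c * f).
Proof.
move=> /H2P[lf hf]; apply/H2P; split; first exact: L2Z.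
by move=> n; rewrite innerZl ?hf ?mulr0//; exact: L2_cjZX.
Qed.

Lemma H2N f : H2 f -> H2 (- f).
Proof.
move=> hf; have -> : - f = cst (-1) * f by apply/funext => z; rewrite !fctE mulN1r.
exact: H2Z.
Qed.

Lemma H2B f g : H2 f -> H2 g -> H2 (f - g).
Proof. by move=> hf hg; apply: H2D => //; exact: H2N. Qed.

Lemma inner_1_cjZX n : inner 1 (cj Z ^+ n.+1 : circle R -> C) = 0.
Proof.
rewrite innerE mul1r -[RHS](@cintegral_ZX R n); congr cintegral.
by apply/funext => z; rewrite /cj !exprfctE rmorphXn/= conjCK.
Qed.

Lemma H2_1 : H2 (1 : circle R -> C).
Proof. by apply/H2P; split; [exact: L2_1|move=> n; exact: inner_1_cjZX]. Qed.

Lemma H2_cst c : H2 (cst c : circle R -> C).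
Proof. by rewrite -[cst c]mulr1; apply: H2Z; exact: H2_1. Qed.

Lemma inner_11 : inner 1 (1 : circle R -> C) = 1.
Proof.
rewrite innerE cj1 mulr1 /cintegral.
have m1 : m setT = 1%E by exact: probability_setT.
rewrite -[RHS]/(1 +i* 0); congr (_ +i* _).
  transitivity (1 * fine (m setT) : R); first exact: Rintegral_cst.
  by rewrite mul1r -[RHS]/(fine 1%E) -m1.
transitivity (0 * fine (m setT) : R); first exact: Rintegral_cst.
by rewrite mul0r.
Qed.

Lemma H2_shift f : H2 f -> H2 (Z * f).
Proof.
move=> /H2P[lf hf]; apply/H2P; split; first exact: L2Z_mul.
by move=> n; rewrite innerMl -exprS.
Qed.

(* [inner f 1] is the value of [f] at the origin of the disc. *)
Definition backward_shift f : circle R -> C := cj Z * (f - cst (inner f 1)).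

Lemma H2_backward_shift f : H2 f -> H2 (backward_shift f).
Proof.
move=> /H2P[lf hf]; apply/H2P; have lc : L2 (cst (inner f 1)) by exact: L2_cst.
have lb : L2 (f - cst (inner f 1)) by exact: L2B.
split; first exact: L2cjZ_mul.
move=> n; rewrite innerMl cjK exprS mulrA [Z * _]mulrC cjZZ mul1r.
have lX k : L2 (cj Z ^+ k : circle R -> C) by exact: L2_cjZX.
rewrite innerBl// -[cst (inner f 1)]mulr1 innerZl//; last exact: L2_1.
(* For [n = 0] the pairing is with 1, and subtracting the mean is exactly what makes it vanish. *)
case: n => [|n]; first by rewrite expr0 inner_11 mulr1 subrr.
by rewrite hf inner_1_cjZX mulr0 subrr.
Qed.

Lemma backward_shiftK f : Z * backward_shift f = f - cst (inner f 1).
Proof. by rewrite /backward_shift mulrA [Z * _]mulrC cjZZ mul1r. Qed.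

Lemma H2_pz P : H2 (pz P).
Proof.
elim/poly_ind: P => [|P c IH]; first by rewrite (pzC 0); exact: H2_cst.
rewrite pzD pzM pzX pzC mulrC; apply: H2D; last exact: H2_cst.
exact: H2_shift.
Qed.

Lemma nsq_Z f : nsq (Z * f) = nsq f.
Proof. by rewrite /nsq innerMl mulrA cjZZ mul1r. Qed.

(** The bound on the size leaves only strictly negative powers of [z] in [conj z ^ N * P]. *)
Lemma inner_H2_antianalytic f N P : H2 f -> (size P <= N)%N ->
  inner f (cj Z ^+ N * pz P) = 0.
Proof.
move=> /H2P[lf hf]; elim: N P => [|N IH] P.
  rewrite leqn0 size_poly_eq0 => /eqP ->; rewrite (pzC 0) expr0 mul1r.
  by rewrite -[cst 0]mulr1 innerZr ?rmorph0 ?mul0r//; exact: L2_1.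
elim/poly_ind: P => [|P c _] sP.
  rewrite (pzC 0) mulrC innerZr ?rmorph0 ?mul0r//; exact: L2_cjZX.
have sPN : (size P <= N)%N.
  move: sP; rewrite size_MXaddC; case: ifP => [/andP[/eqP -> _]|_]; last by [].
  by rewrite size_poly0.
have -> : cj Z ^+ N.+1 * pz (P * 'X + c%:P) = cj Z ^+ N * pz P + cst c * cj Z ^+ N.+1.
  rewrite pzD pzM pzX pzC mulrDr [X in _ + X]mulrC; congr (_ + _).
  by rewrite exprSr mulrACA cjZZ mulr1.
have lX k : L2 (cj Z ^+ k : circle R -> C) by exact: L2_cjZX.
rewrite innerDr//; last 2 first.
- by apply: L2M_bounded; [exact: bounded_symbolX bounded_symbol_cjZ|exact: bounded_symbol_L2 (bounded_symbol_pz P)].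
- exact: L2Z.
by rewrite IH// innerZr// hf mulr0 addr0.
Qed.

(* A trigonometric polynomial [conj z ^ N * P] splits into its analytic part
   and an antianalytic part orthogonal to [H2]. *)
Lemma H2_pz_dense f (e : R) : H2 f -> 0 < e -> exists P, nsq (f - pz P) < e.
Proof.
move=> hf e0; have lf := H2_L2 hf.
have [N [P fP]] := L2_trig_dense lf e0.
exists (drop_poly N P); apply: le_lt_trans fP.
set D := pz (drop_poly N P); pose L := cj Z ^+ N * pz (take_poly N P).
have hfD : H2 (f - D) by apply: H2B => //; exact: H2_pz.
have lL : L2 L.
  apply: bounded_symbol_L2; apply: bounded_symbolM; last exact: bounded_symbol_pz.
  by apply: bounded_symbolX; exact: bounded_symbol_cjZ.
have -> : f - cj Z ^+ N * pz P = (f - D) - L.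
  have e1 : cj Z ^+ N * (D * Z ^+ N) = D by rewrite mulrCA -exprMn cjZZ expr1n mulr1.
  by rewrite -[in LHS](poly_take_drop N P) pzD pzM pzXn mulrDr e1 /L; ring.
have lfD := H2_L2 hfD; have lNL := L2N lL.
rewrite (nsqD lfD lNL) innerNr//.
have -> : inner (f - D) L = 0 by apply: inner_H2_antianalytic => //; exact: size_take_poly.
by rewrite oppr0/= mulr0 addr0 lerDl nsq_ge0.
Qed.

(** Formally, the integral of [z f g] is the value at 0 of an analytic function vanishing there. For
    a polynomial [f] each factor [z] is moved onto [g], which stays in [H2]; density of polynomials
    gives the general case. *)
Lemma inner_H2_conj f g : H2 f -> H2 g -> inner (Z * f) (cj g) = 0.
Proof.
move=> hf hg; have lg := L2_cj (H2_L2 hg).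
apply: (@sqn_small _ _ (nsq (cj g))) => e e0.
have [P fP] := H2_pz_dense hf e0.
have lfP : L2 (f - pz P) by apply: L2B; [exact: H2_L2|exact: H2_L2 (H2_pz P)].
have -> : inner (Z * f) (cj g) = inner (Z * (f - pz P)) (cj g).
  have lP := H2_L2 (H2_pz P); have lf := H2_L2 hf.
  rewrite mulrBr innerBl//; try exact: L2Z_mul.
  suff -> : inner (Z * pz P) (cj g) = 0 by rewrite subr0.
  elim/poly_ind: P g hg lg {fP lfP lP} => [|P c IH] g hg lg.
    have lZ : L2 (Z : circle R -> C) by apply: bounded_symbol_L2; exact: bounded_symbolZ.
    by rewrite (pzC 0) mulrC (innerZl _ lZ lg) mul0r.
  rewrite pzD pzM pzX pzC mulrDr innerDl//; last 2 first.
  - by apply: L2Z_mul; apply: bounded_symbol_L2; apply: bounded_symbolM; [exact: bounded_symbol_pz|exact: bounded_symbolZ].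
  - by apply: L2Z_mul; exact: L2_cst.
  rewrite [pz P * Z]mulrC (innerMl Z (Z * pz P)) -cjM IH ?add0r; last 2 first.
  - exact: H2_shift.
  - by apply: L2_cj; apply: L2Z_mul; exact: H2_L2.
  rewrite mulrC innerZl//; last by apply: bounded_symbol_L2; exact: bounded_symbolZ.
  by have /H2P[_ /(_ 0%N)] := hg; rewrite expr1 -[in inner Z _](cjK Z) inner_cj => ->; rewrite mulr0.
apply: le_trans (cauchy_schwarz _ _) _ => //; first exact: L2Z_mul.
by rewrite nsq_Z ler_wpM2r ?nsq_ge0// ltW.
Qed.

End hardy_space.
Lemma bounded_symbolN (R : realType) (f : circle R -> R[i]) :
  bounded_symbol f -> bounded_symbol (- f).
Proof.
move=> bf; have -> : - f = cst (-1) * f by apply/funext => z; rewrite !fctE mulN1r.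
by apply: bounded_symbolM => //; exact: bounded_symbol_cst.
Qed.

(** A product of [L2] functions need not be in [L2], so the tactic looks for a factor, on either
    side, that [bounded_auto] shows to be bounded. Membership in [H2] or in the model space is taken
    from the context. *)
Ltac L2_auto := first
  [ assumption
  | lazymatch goal with
    | |- L2 (_ + _) => apply: L2D; L2_auto
    | |- L2 (- _) => apply: L2N; L2_auto
    | |- L2 (cj _) => apply: L2_cj; L2_auto
    | |- L2 (cst _) => exact: L2_cst
    | |- L2 (1) => exact: L2_1
    | |- L2 (_ * _) => first
        [ apply: L2M_bounded; [solve [bounded_auto] | L2_auto]
        | rewrite mulrC; apply: L2M_bounded; [solve [bounded_auto] | L2_auto] ]
    | |- L2 (backward_shift _) => rewrite /backward_shift; L2_auto
    | |- L2 _ => first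
        [ match goal with H : model _ _ |- _ => exact: (H2_L2 (proj1 H)) end
        | match goal with H : H2 _ |- _ => exact: (H2_L2 H) end
        | by apply: bounded_symbol_L2; bounded_auto ]
    end ]
with bounded_auto := first
  [ assumption
  | lazymatch goal with
    | |- bounded_symbol (_ + _) => apply: bounded_symbolD; bounded_auto
    | |- bounded_symbol (- _) => apply: bounded_symbolN; bounded_auto
    | |- bounded_symbol (_ * _) => apply: bounded_symbolM; bounded_auto
    | |- bounded_symbol (cj _) => apply: bounded_symbol_cj; bounded_auto
    | |- bounded_symbol (cst _) => exact: bounded_symbol_cst
    | |- bounded_symbol (1) => exact: bounded_symbol1
    | |- bounded_symbol Z => exact: bounded_symbolZ
    | |- bounded_symbol (pz _) => exact: bounded_symbol_pz
    | |- bounded_symbol (backward_shift _) => rewrite /backward_shift; bounded_auto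
    end ].

(** * The model space *)

Section model_space.
Context {R : realType}.
Local Notation C := R[i].
Local Notation m := (@arc_measure R).
Implicit Types (f g h : circle R -> C) (c : C) (P Q : {poly C}).

Variable u : circle R -> C.
Hypothesis u_inner : inner_function u.

Let lu : L2 u. Proof. by case: u_inner => -[]. Qed.

Let hu : H2 u. Proof. by case: u_inner. Qed.

Lemma bounded_inner_function : bounded_symbol u.
Proof.
split; first exact: L2_cmeasurable.
by exists 1; apply: filterS u_inner.2 => z ->.
Qed.

Let bu := bounded_inner_function.

Lemma inner_cjuuM f g : L2 f -> L2 g -> inner f (cj u * (u * g)) = inner f g.
Proof.
move=> lf lg; apply: ae_eq_inner => //; [L2_auto|exact: aeW|].
apply: filterS u_inner.2 => z uz.
by rewrite !mulrfctE /cj mulrA [_^* * _]mulrC -normCK uz expr1n mul1r.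
Qed.

Lemma inner_uu f g : L2 f -> L2 g -> inner (u * f) (u * g) = inner f g.
Proof. by move=> lf lg; rewrite innerMl inner_cjuuM. Qed.

Lemma inner_ZZ f g : inner (Z * f) (Z * g) = inner f g.
Proof. by rewrite innerMl mulrA cjZZ mul1r. Qed.

Lemma inner_Z1 f : H2 f -> inner (Z * f) 1 = 0.
Proof. by move=> /H2P[_ /(_ 0%N)]; rewrite innerMl mulr1 expr1. Qed.

Lemma inner_cjZ f : H2 f -> inner f (cj Z) = 0.
Proof. by move=> /H2P[_ /(_ 0%N)]; rewrite expr1. Qed.

Lemma inner_1r f : L2 f -> inner 1 f = (inner f 1)^*.
Proof. by move=> lf; rewrite innerC//; L2_auto. Qed.

(** The product [f g] is only known to be integrable, so [H2] says nothing about it directly; moving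
    [g] to the other side reduces to the orthogonality of [z H2] and [conj H2]. *)
Lemma inner_1_ZM f g : H2 f -> H2 g -> inner 1 (f * (Z * g)) = 0.
Proof.
move=> hf hg; have := inner_H2_conj hf hg => fg.
have -> : inner 1 (f * (Z * g)) = inner (cj g) (Z * f).
  by rewrite !innerE !cjM; congr cintegral; ring.
by rewrite -innerC ?fg ?rmorph0//; L2_auto.
Qed.

Lemma model_mul_u f g : model u f -> H2 g -> inner f (u * g) = 0.
Proof. by move=> [_ H] hg; exact: H. Qed.

Lemma modelI f : H2 f -> (forall g, H2 g -> inner f (u * g) = 0) -> model u f.
Proof. by []. Qed.

Lemma model_inner_u f : model u f -> inner f u = 0.
Proof. by move=> mf; rewrite -[u]mulr1; apply: model_mul_u => //; exact: H2_1. Qed.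

Lemma inner_u_model f : model u f -> inner u f = 0.
Proof. by move=> mf; rewrite -innerC ?model_inner_u ?rmorph0//; L2_auto. Qed.

Lemma inner_u_uM g : H2 g -> inner u (u * g) = (inner g 1)^*.
Proof.
move=> hg; rewrite -[X in inner X _]mulr1 inner_uu ?inner_1r//; L2_auto.
Qed.

(** Multiplicativity at the origin: writing [g = g(0) + z h] leaves only [g(0) u], the rest having
    mean zero. *)
Lemma inner_1_uM g : H2 g -> inner 1 (u * g) = (inner u 1)^* * (inner g 1)^*.
Proof.
move=> hg; have hb := H2_backward_shift hg.
have -> : u * g = cst (inner g 1) * u + u * (Z * backward_shift g).
  by rewrite backward_shiftK; ring.
rewrite innerDr ?innerZr ?inner_1_ZM ?addr0 ?inner_1r//; try L2_auto.
by rewrite mulrC.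
Qed.

Lemma modelD f g : model u f -> model u g -> model u (f + g).
Proof.
move=> mf mg; apply: modelI; first by apply: H2D; [case: mf|case: mg].
by move=> h hh; rewrite innerDl ?model_mul_u ?addr0//; L2_auto.
Qed.

Lemma modelZ c f : model u f -> model u (cst c * f).
Proof.
move=> mf; apply: modelI; first by apply: H2Z; case: mf.
by move=> h hh; rewrite innerZl ?model_mul_u ?mulr0//; L2_auto.
Qed.

Lemma modelN f : model u f -> model u (- f).
Proof.
move=> mf; have -> : - f = cst (-1) * f by apply/funext => z; rewrite !fctE mulN1r.
exact: modelZ.
Qed.

Lemma modelB f g : model u f -> model u g -> model u (f - g).
Proof. by move=> mf mg; apply: modelD => //; exact: modelN. Qed.

Lemma model0 : model u 0.
Proof.
apply: modelI; first by have := H2_cst (0 : C).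
by move=> g hg; rewrite -[X in inner X _](mul0r u) -[0 : circle R -> C]/(cst 0) innerZl ?mul0r//; L2_auto.
Qed.

Lemma conjugationE f : conjugation u f = u * cj (Z * f).
Proof. by []. Qed.

(** The two defining conditions exchange roles: [f] orthogonal to [u H2] makes the image analytic,
    and [f] analytic makes the image orthogonal to [u H2]. *)
Lemma model_conjugation f : model u f -> model u (conjugation u f).
Proof.
move=> mf; have hf := proj1 mf; rewrite conjugationE; apply: modelI.
  apply/H2P; split; first L2_auto.
  move=> n.
  have -> : inner (u * cj (Z * f)) (cj Z ^+ n.+1) = inner (Z * (u * pz 'X^n)) (Z * f).
    rewrite -[RHS]inner_cj innerMl !cjM pzXn; congr (cintegral (_ * cj _)).
    rewrite (_ : cj (Z ^+ n) = cj Z ^+ n); first by rewrite exprS; ring.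
    by apply/funext => z; rewrite /cj !exprfctE rmorphXn.
  rewrite inner_ZZ -innerC ?model_mul_u ?rmorph0//; try L2_auto; exact: H2_pz.
move=> g hg; rewrite inner_uu//; try L2_auto.
rewrite -[g]cjK inner_cj -innerC ?inner_H2_conj ?rmorph0//; L2_auto.
Qed.

Lemma inner_conjugation f g : inner f (conjugation u g) = inner g (conjugation u f).
Proof. by rewrite !conjugationE !innerE !cjM !cjK; congr cintegral; ring. Qed.

Lemma model_backward_shift f : model u f -> model u (backward_shift f).
Proof.
move=> mf; have hf := proj1 mf; apply: modelI; first exact: H2_backward_shift.
move=> g hg; rewrite innerMl cjK mulrCA innerBl//; try L2_auto.
rewrite model_mul_u ?sub0r//; last exact: H2_shift.
by rewrite -[cst _]mulr1 innerZl ?inner_1_ZM ?mulr0 ?oppr0//; L2_auto.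
Qed.

(* This is [S_u f], because [z f] belongs to the sum of the model space and
   the line spanned by [u]. *)
Definition fshift f : circle R -> C := Z * f - cst (inner (Z * f) u) * u.

Lemma model_fshift f : model u f -> model u (fshift f).
Proof.
move=> mf; have hf := proj1 mf; apply: modelI.
  by apply: H2B; [exact: H2_shift|exact: H2Z].
move=> g hg; rewrite innerBl//; try L2_auto.
rewrite innerZl//; last L2_auto.
rewrite inner_u_uM//.
have hb := H2_backward_shift hg.
(* The component along [u] is cancelled by the correction in [fshift]; the remainder is [z] times an
   element of [u H2], whose pairing with [z f] vanishes. *)
have -> : u * g = cst (inner g 1) * u + Z * (u * backward_shift g).
  by rewrite mulrCA backward_shiftK; ring.
rewrite innerDr//; try L2_auto.
by rewrite innerZr ?inner_ZZ ?model_mul_u ?addr0//; [ring|L2_auto].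
Qed.

Definition u0 : C := inner u 1.

(* The projection of 1, that is, the reproducing kernel at the origin. *)
Definition k0 : circle R -> C := 1 - cst u0^* * u.

Lemma model_k0 : model u k0.
Proof.
apply: modelI; first by apply: H2B; [exact: H2_1|exact: H2Z].
move=> g hg; rewrite innerBl//; try L2_auto.
by rewrite innerZl ?inner_1_uM ?inner_u_uM ?subrr//; L2_auto.
Qed.

Lemma bounded_k0 : bounded_symbol k0.
Proof. by rewrite /k0; bounded_auto. Qed.

Lemma inner_k0r f : model u f -> inner f k0 = inner f 1.
Proof.
move=> mf; rewrite /k0 innerBr ?innerZr ?model_inner_u ?mulr0 ?subr0//; L2_auto.
Qed.

(* Almost everywhere equal to [conjugation u k0]. *)
Definition kt : circle R -> C := backward_shift u.

Lemma model_kt : model u kt.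
Proof.
apply: modelI; first exact: H2_backward_shift.
move=> g hg; have lg := H2_L2 hg.
rewrite innerMl cjK mulrCA innerBl//; try L2_auto.
rewrite inner_u_uM; last exact: H2_shift.
rewrite inner_Z1// rmorph0 sub0r -[cst _]mulr1 innerZl; try L2_auto.
by rewrite inner_1_ZM ?mulr0 ?oppr0.
Qed.

Lemma bounded_kt : bounded_symbol kt.
Proof. by rewrite /kt; bounded_auto. Qed.

Definition mb f : Prop := model u f /\ bounded_symbol f.

Lemma mb_model_bounded f : mb f -> model_bounded u f.
Proof. by move=> [mf [_ bf]]. Qed.

Lemma model_bounded_mb f : model_bounded u f -> mb f.
Proof. by move=> [mf bf]; split => //; split => //; apply: L2_cmeasurable; L2_auto. Qed.

(* [kap n] is the projection of [z ^ n]. *)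
Fixpoint kap n : circle R -> C := if n is n'.+1 then fshift (kap n') else k0.

Lemma mb_fshift f : mb f -> mb (fshift f).
Proof. by move=> [mf bf]; split; [exact: model_fshift|rewrite /fshift; bounded_auto]. Qed.

Lemma mb_kap n : mb (kap n).
Proof.
elim: n => [|n IH]; first by split; [exact: model_k0|exact: bounded_k0].
exact: mb_fshift.
Qed.

Inductive kspan : (circle R -> C) -> Prop :=
| kspan0 : kspan 0
| kspanD f c n : kspan f -> kspan (f + cst c * kap n).

Lemma mb_kspan f : kspan f -> mb f.
Proof.
elim=> [|{}f c n _ [mf bf]].
  by split; [exact: model0|exact: (bounded_symbol_cst 0)].
by have [mk bk] := mb_kap n; split; [apply: modelD => //; exact: modelZ|bounded_auto].
Qed.

Lemma kspan_fshift f : kspan f -> kspan (fshift f).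
Proof.
elim=> [|{}f c n kf IH].
  rewrite (_ : fshift 0 = 0); first exact: kspan0.
  have u00 : inner 0 u = 0.
    rewrite -[RHS](mul0r (inner u u)) -innerZl//; congr inner.
    by apply/funext => z; rewrite !fctE mul0r.
  by rewrite /fshift mulr0 u00; apply/funext => z; rewrite !fctE mul0r subr0.
rewrite (_ : fshift _ = fshift f + cst c * kap n.+1); first exact: kspanD.
have [mf bf] := mb_kspan kf; have [mk bk] := mb_kap n.
rewrite /= /fshift (_ : Z * (f + cst c * kap n) = Z * f + cst c * (Z * kap n)); last by ring.
rewrite innerDl//; try L2_auto; rewrite innerZl//; try L2_auto.
by apply/funext => z; rewrite !fctE; ring.
Qed.

(** Horner's scheme: multiplying by [z] and adding a constant become [fshift] and adding a multiple
    of [k0], up to a multiple of [u] that [Q] absorbs. So the projection of a polynomial lies in the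
    span. *)
Lemma kspan_poly P : exists2 k, kspan k & exists Q, pz P - u * pz Q = k.
Proof.
elim/poly_ind: P => [|P c [k kk [Q kE]]].
  exists 0; first exact: kspan0.
  by exists 0; rewrite (pzC 0); apply/funext => z; rewrite !fctE mulr0 subr0.
exists (fshift k + cst c * kap 0); first by apply: kspanD; exact: kspan_fshift.
exists (Q * 'X + (inner (Z * k) u + c * u0^*)%:P).
rewrite !pzD !pzM !pzX !pzC /= /k0 /fshift; move: (inner (Z * k) u) => a; rewrite -kE.
by apply/funext => z; rewrite !fctE; ring.
Qed.

(** If a polynomial [P] is near [h], its projection [k = P - u Q] is at least as near: [h - k] is
    orthogonal to [u Q], so Pythagoras applies. *)
Lemma kspan_dense h (e : R) : model u h -> 0 < e ->
  exists2 k, kspan k & nsq (h - k) < e.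
Proof.
move=> mh e0; have [P hP] := H2_pz_dense (proj1 mh) e0.
have [k kk [Q kE]] := kspan_poly P; exists k => //.
have [mk bk] := mb_kspan kk.
apply: le_lt_trans hP.
have -> : h - pz P = (h - k) - u * pz Q by rewrite -kE; ring.
have lhk : L2 (h - k) by L2_auto.
have luQ : L2 (- (u * pz Q)) by L2_auto.
rewrite (nsqD lhk luQ) innerNr//; last L2_auto.
rewrite model_mul_u ?oppr0/= ?mulr0 ?addr0 ?lerDl ?nsq_ge0//.
  exact: modelB.
exact: H2_pz.
Qed.

(** * Truncated Toeplitz operators *)

Lemma symbol_inner A Phi f h : symbol u A Phi -> mb f -> model u h ->
  inner (A f) h = inner (Phi * f) h.
Proof.
move=> [lPhi H] mbf mh; have [mf bf] := mbf.
have [mAf Hf] := H _ (mb_model_bounded mbf).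
apply/esym/eqP; rewrite -subr_eq0 -innerBl; try L2_auto.
by apply/eqP; exact: Hf.
Qed.

Lemma symbol_model A Phi f : symbol u A Phi -> mb f -> model u (A f).
Proof. by move=> [_ H] /mb_model_bounded/H[]. Qed.

Lemma symbolI A Phi : L2 Phi -> (forall f, mb f -> model u (A f)) ->
  (forall f h, mb f -> model u h -> inner (A f) h = inner (Phi * f) h) ->
  symbol u A Phi.
Proof.
move=> lPhi mA HA; split => // f /model_bounded_mb mbf; have [mf bf] := mbf.
have mAf := mA _ mbf; split => // h mh.
by rewrite -[fun z => _]/(Phi * f - A f) innerBl ?HA ?subrr//; L2_auto.
Qed.

Lemma mb_conjugation f : mb f -> mb (conjugation u f).
Proof.
by move=> [mf bf]; split; [exact: model_conjugation|rewrite conjugationE; bounded_auto].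
Qed.

(* Complex symmetry: the operator below is the adjoint of [A]. *)
Lemma symbol_adjoint A Phi : symbol u A Phi ->
  symbol u (fun g => conjugation u (A (conjugation u g))) (cj Phi).
Proof.
move=> sA; have lPhi := proj1 sA; apply: symbolI; first L2_auto.
  move=> f /mb_conjugation mf; apply: model_conjugation; exact: symbol_model sA mf.
move=> g h mbg mh; have mbCg := mb_conjugation mbg.
have mACg := symbol_model sA mbCg; have mCh := model_conjugation mh.
have [mg bg] := mbg.
have mCACg := model_conjugation mACg.
rewrite -innerC; try L2_auto.
rewrite inner_conjugation innerC; try L2_auto.
rewrite -innerC; try L2_auto.
rewrite (symbol_inner sA mbCg mCh) !conjugationE.
rewrite mulrCA inner_uu; try L2_auto.
rewrite -[Phi]cjK -cjM inner_cj mulrCA inner_ZZ innerC ?cjK//; L2_auto.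
Qed.

Lemma bounded_operator_nsq A : bounded_operator u A ->
  exists2 K : R, 0 <= K & forall f, model u f -> nsq (A f) <= K * nsq f.
Proof.
move=> bA; have [M HM] := bounded_operator_bound bA.
exists (M ^+ 2); first exact: sqr_ge0.
move=> f mf; have mAf := bounded_operator_model bA mf.
have lf : L2 f by L2_auto.
have lAf : L2 (A f) by L2_auto.
have := HM _ mf; rewrite /norm2 -/(nsq f) -/(nsq (A f)) => h.
rewrite -(sqr_sqrtr (nsq_ge0 lf)) -(sqr_sqrtr (nsq_ge0 lAf)) -exprMn.
by rewrite lerXn2r// nnegrE ?sqrtr_ge0// (le_trans _ h)// sqrtr_ge0.
Qed.

Lemma bounded_operatorB A f g h : bounded_operator u A -> model u f -> model u g -> L2 h ->
  inner (A f) h = inner (A (f - g)) h + inner (A g) h.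
Proof.
move=> bA mf mg lh.
have mAf := bounded_operator_model bA mf.
have mAg := bounded_operator_model bA mg.
have mfg := modelB mf mg; have mAfg := bounded_operator_model bA mfg.
rewrite -innerDl; try L2_auto.
apply: ae_eq_inner => //; try L2_auto; last exact: aeW.
have := bounded_operator_linear bA 1 mfg mg.
have -> : (fun w => 1 * (f - g) w + g w) = f.
  by apply/funext => w; rewrite !fctE mul1r subrK.
by apply: filterS => z ->; rewrite addrfctE mul1r.
Qed.

(** Here [h] may be unbounded, and then the symbol does not describe [A h]. On the span of the
    [kap n] the identity is a computation with the symbol; boundedness of [A] and density give the
    rest. *)
Lemma bounded_operator_adjoint A Phi h g : bounded_operator u A -> symbol u A Phi ->
  model u h -> mb g ->
  inner (A h) g = inner h (conjugation u (A (conjugation u g))).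
Proof.
move=> bA sA mh mbg; have [mg bg] := mbg.
set Ag := conjugation u _.
have mAg : model u Ag by apply: symbol_model (symbol_adjoint sA) mbg.
have lPhi := proj1 sA.
have [K K0 HK] := bounded_operator_nsq bA.
apply/eqP; rewrite -subr_eq0; apply/eqP.
(* The error splits into a pairing of [A (h - k)] with [g] and one of [h - k] with [Ag]; each term
   of the constant is the Cauchy-Schwarz bound for one of them. *)
apply: (@sqn_small _ _ (2 * (K * nsq g) + 2 * nsq Ag)) => e e0.
have [k kk hk] := kspan_dense mh e0; have mbk := mb_kspan kk; have [mk bk] := mbk.
have mhk := modelB mh mk; have mAhk := bounded_operator_model bA mhk.
have kE : inner (A k) g = inner k Ag.
  rewrite (symbol_inner sA mbk mg) -[RHS]innerC; try L2_auto.
  rewrite (symbol_inner (symbol_adjoint sA) mbg mk) innerC; try L2_auto.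
  by rewrite innerMl.
have lg : L2 g by L2_auto.
rewrite (bounded_operatorB bA mh mk lg) kE.
have -> : inner h Ag = inner (h - k) Ag + inner k Ag.
  by rewrite innerBl ?subrK//; L2_auto.
rewrite opprD addrACA subrr addr0.
apply: (le_trans (sqn_leD _ _)).
rewrite [leRHS]mulrDr; apply: lerD.
  rewrite [leRHS]mulrCA ler_wpM2l//.
  have lAhk : L2 (A (h - k)) by L2_auto.
  apply: (le_trans (cauchy_schwarz lAhk lg)); rewrite mulrA ler_wpM2r ?nsq_ge0//.
  by apply: (le_trans (HK _ mhk)); rewrite mulrC ler_wpM2r// ltW.
rewrite [leRHS]mulrCA ler_wpM2l// -[- inner _ _]mulN1r sqnM (_ : sqn (-1) = 1); last first.
  by rewrite sqnE /= oppr0 expr0n addr0 sqrrN expr1n.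
have lhk : L2 (h - k) by L2_auto.
have lAg : L2 Ag by L2_auto.
rewrite mul1r; apply: (le_trans (cauchy_schwarz lhk lAg)).
by rewrite ler_wpM2r ?nsq_ge0// ltW.
Qed.

(** * Products of truncated Toeplitz operators *)

Definition mb0 f : Prop := mb f /\ inner f 1 = 0.

Lemma mb0_cjZ f : mb0 f -> mb (cj Z * f).
Proof.
move=> [[mf bf] f0]; have -> : cj Z * f = backward_shift f.
  by rewrite /backward_shift f0; congr (_ * _); apply/funext => z; rewrite !fctE subr0.
by split; [exact: model_backward_shift|bounded_auto].
Qed.

Lemma inner_cjZ_cst f c : H2 f -> inner f (cj Z * cst c) = 0.
Proof. by move=> hf; rewrite mulrC innerZr ?inner_cjZ ?mulr0//; L2_auto. Qed.

Lemma inner_mul_cjZ Phi f g : inner (Phi * (cj Z * f)) g = inner (Phi * f) (Z * g).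
Proof. by rewrite [X in inner X _]mulrCA (innerMl (cj Z)) cjK. Qed.

(* The commutation defect of a truncated Toeplitz operator with the backward shift. *)
Lemma symbol_shift B Phi f : symbol u B Phi -> mb0 f ->
  let X := B (cj Z * f) in let beta := inner (Phi * f) 1 in let b := inner (Phi * f) u in
  (forall g, L2 g -> inner (B f) g = inner (Z * X) g + beta * inner 1 g - b * inner u g) /\
  inner (Z * X) u = b - beta * u0^*.
Proof.
move=> sB mf0; have [mbf f0] := mf0; have [mf bf] := mbf; have mbzf := mb0_cjZ mf0.
move=> X beta b; have lPhi := proj1 sB.
have mX : model u X := symbol_model sB mbzf.
have mBf : model u (B f) := symbol_model sB mbf.
have hX := proj1 mX.
have bsE h : model u h -> inner (Z * X) h = inner (Phi * f) h - (inner h 1)^* * beta.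
  move=> mh; have mbh := model_backward_shift mh.
  have -> : inner (Z * X) h = inner X (backward_shift h).
    rewrite innerMl /backward_shift mulrBr innerBr ?inner_cjZ_cst ?subr0//; L2_auto.
  rewrite (symbol_inner sB mbzf mbh) inner_mul_cjZ backward_shiftK.
  rewrite innerBr; try L2_auto.
  by rewrite -[cst (inner h 1)]mulr1 innerZr//; L2_auto.
have cE : inner (Z * X) u = b - beta * u0^*.
  rewrite innerMl.
  have -> : inner X (cj Z * u) = inner X kt.
    rewrite /kt /backward_shift mulrBr innerBr ?inner_cjZ_cst ?subr0//; L2_auto.
  rewrite (symbol_inner sB mbzf model_kt) inner_mul_cjZ backward_shiftK.
  rewrite innerBr; try L2_auto.
  rewrite -[cst _]mulr1 innerZr; try L2_auto.
  by rewrite [beta * _]mulrC.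
split => // g lg.
(* The identity [B f = S_u X + beta k0] is known only through pairings with the model space; as the
   difference lies in that space, pairing it with itself shows that it is null. *)
pose W := B f - fshift X - cst beta * k0.
have mW : model u W.
  by apply: modelB; [apply: modelB => //; exact: model_fshift|apply: modelZ; exact: model_k0].
have lW : L2 W by L2_auto.
have mk0 := model_k0; have bk0 := bounded_k0.
have mSX := model_fshift mX.
have W0 : nsq W = 0.
  rewrite /nsq {1}/W innerBl; try L2_auto.
  rewrite innerBl; try L2_auto.
  rewrite (symbol_inner sB mbf mW) innerZl; try L2_auto.
  have -> : inner k0 W = (inner W 1)^* by rewrite -(inner_k0r mW) innerC//; L2_auto.
  rewrite {1}/fshift innerBl; try L2_auto.
  rewrite innerZl; try L2_auto.
  rewrite inner_u_model// mulr0 subr0 bsE//.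
  by move: (inner (Phi * f) W) => p; rewrite (_ : _ - _ - _ = 0) //; ring.
have W0ae := nsq_eq0 lW W0.
have -> : inner (B f) g = inner (Z * X + cst beta * 1 - cst b * u) g.
  apply: ae_eq_inner => //; try L2_auto; last exact: aeW.
  apply: filterS W0ae => z; rewrite /W /fshift cE /k0 !fctE => Wz.
  by apply/eqP; rewrite -subr_eq0 -Wz; apply/eqP; ring.
rewrite innerBl; try L2_auto.
rewrite innerDl; try L2_auto.
by rewrite !innerZl//; L2_auto.
Qed.

(** Since [A B] has a symbol, the pairing of [B f] with [A' g] equals that of [X] with [Y].
    Substituting [B f = z X + beta - b u] and [A' g = z Y + alpha - a u], the [u(0)] terms cancel
    and [beta conj(alpha) = b conj(a)] is left. *)
Lemma tto_mul_relation A B Phi Psi Theta f g :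
  bounded_operator u A -> symbol u A Phi -> symbol u B Psi ->
  symbol u (fun f => A (B f)) Theta -> mb0 f -> mb0 g ->
  inner (Psi * f) 1 * (inner (cj Phi * g) 1)^* =
  inner (Psi * f) u * (inner (cj Phi * g) u)^*.
Proof.
move=> bA sA sB sAB mf0 mg0; have [mbf _] := mf0; have [mbg _] := mg0.
have [mf bf] := mbf; have [mg bg] := mbg.
have mbzf := mb0_cjZ mf0; have mbzg := mb0_cjZ mg0.
have sA' := symbol_adjoint sA; set A' := (fun g => _) in sA'.
have ABE h k : mb h -> mb k -> inner (B h) (A' k) = inner (Theta * h) k.
  move=> mbh mbk; rewrite -(bounded_operator_adjoint bA sA (symbol_model sB mbh) mbk).
  by apply: (symbol_inner sAB) => //; case: mbk.
have [sBf sBu] := symbol_shift sB mf0.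
have [sAg sAu] := symbol_shift sA' mg0.
set X := B (cj Z * f) in sBf sBu; set Y := A' (cj Z * g) in sAg sAu.
set beta := inner (Psi * f) 1 in sBf sBu *; set b := inner (Psi * f) u in sBf sBu *.
set alpha := inner (cj Phi * g) 1 in sAg sAu *; set a := inner (cj Phi * g) u in sAg sAu *.
have mX : model u X := symbol_model sB mbzf.
have mY : model u Y := symbol_model sA' mbzg.
have mAg : model u (A' g) := symbol_model sA' mbg.
have hX := proj1 mX; have hY := proj1 mY.
have XY : inner (B f) (A' g) = inner X Y.
  rewrite ABE// -[inner X Y]/(inner (B _) (A' _)) ABE// inner_mul_cjZ.
  by rewrite mulrA [Z * _]mulrC cjZZ mul1r.
have lX : L2 (Z * X) by L2_auto.
have := sBf (A' g) (H2_L2 (proj1 mAg)); rewrite XY inner_u_model// mulr0 subr0.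
have -> : inner (Z * X) (A' g) = inner X Y - a^* * (b - beta * u0^*).
  rewrite -innerC; try L2_auto.
  rewrite sAg// inner_ZZ -sBu -[inner 1 (Z * X)]innerC; try L2_auto.
  rewrite inner_Z1// rmorph0 mulr0 addr0 rmorphB/= innerC; try L2_auto.
  by rewrite rmorphM/= innerC//; L2_auto.
have -> : inner 1 (A' g) = alpha^* - a^* * u0^*.
  rewrite -innerC; try L2_auto.
  rewrite sAg; last L2_auto.
  by rewrite inner_Z1// add0r inner_11 mulr1 rmorphB/= rmorphM.
move=> /eqP; rewrite -subr_eq0 => /eqP h.
apply/eqP; rewrite -subr_eq0; apply/eqP.
by rewrite -[RHS]oppr0 -h; ring.
Qed.

(** The function is [C] applied to [conj z f], and its mean vanishes because [f] is orthogonal to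
    [u]. *)
Lemma mb0_conj f : mb0 f -> mb0 (u * cj f).
Proof.
move=> mf0; have [[mf bf] f0] := mf0; have [mzf bzf] := mb0_cjZ mf0.
split; first split.
- have -> : u * cj f = conjugation u (cj Z * f).
    by rewrite conjugationE mulrA [Z * _]mulrC cjZZ mul1r.
  exact: model_conjugation.
- bounded_auto.
- by rewrite mulrC innerMl cjK mulr1 -innerC ?model_inner_u ?rmorph0//; L2_auto.
Qed.

(** The preceding relation at [u conj f] in place of [f]: this turns the pairings with [1] and [u]
    into the functionals [r] and [p]. *)
Lemma tto_mul_proportional A B Phi Psi Theta f g :
  bounded_operator u A -> symbol u A Phi -> symbol u B Psi ->
  symbol u (fun f => A (B f)) Theta -> mb0 f -> mb0 g ->
  inner Psi (cj u * f) * inner Phi g = inner Psi f * inner Phi (cj u * g).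
Proof.
move=> bA sA sB sAB mf0 mg0.
have lPhi := proj1 sA; have lPsi := proj1 sB.
have [[mf bf] f0] := mf0; have [[mg bg] g0] := mg0.
have := tto_mul_relation bA sA sB sAB (mb0_conj mf0) mg0.
have -> : inner (Psi * (u * cj f)) 1 = inner Psi (cj u * f).
  by rewrite [Psi * _]mulrC innerMl cjM cjK mulr1.
have -> : inner (Psi * (u * cj f)) u = inner Psi f.
  rewrite mulrCA -[X in inner _ X]mulr1 inner_uu; try L2_auto.
  by rewrite mulrC innerMl cjK mulr1.
have -> : (inner (cj Phi * g) 1)^* = inner Phi g.
  by rewrite innerMl cjK mulr1 innerC//; L2_auto.
have -> // : (inner (cj Phi * g) u)^* = inner Phi (cj u * g).
rewrite innerC; try L2_auto.
by rewrite -innerMl mulrC [in RHS]innerE [in LHS]innerE !cjM !cjK; congr cintegral; ring.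
Qed.

Lemma k0_normE : inner k0 1 = 1 - u0^* * u0.
Proof. by rewrite /k0 innerBl ?inner_11 ?innerZl//; L2_auto. Qed.

(** * Consequences of non-constancy: a symbol is recovered from its two functionals *)

Hypothesis u_nonconstant : nonconstant u.

(* The mean of [u] has modulus less than 1, otherwise the norm of [u - u0] vanishes. *)
Lemma k0_norm_neq0 : inner k0 1 != 0.
Proof.
apply/eqP; rewrite k0_normE => n0; apply: u_nonconstant; exists u0.
have l0 : L2 (u - cst u0) by L2_auto.
have : nsq (u - cst u0) = 0.
  rewrite /nsq innerBl; try L2_auto.
  rewrite innerBr; try L2_auto.
  rewrite innerBr; try L2_auto.
  rewrite -[cst u0]mulr1 innerZr; try L2_auto.
  rewrite innerZl; try L2_auto.
  rewrite innerZl; try L2_auto.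
  rewrite innerZr; try L2_auto.
  rewrite inner_11 -[inner 1 u]innerC; try L2_auto.
  have -> : inner u u = 1.
    by rewrite -[X in inner X _]mulr1 -[X in inner _ X]mulr1 inner_uu ?inner_11//; L2_auto.
  by rewrite -/u0 mulr1 [u0 * u0^*]mulrC subrr subr0 n0.
by move/(nsq_eq0 l0); apply: filterS => z; rewrite addrfctE opprfctE => /eqP; rewrite subr_eq0 => /eqP.
Qed.

Lemma mb_k0 : mb k0. Proof. by split; [exact: model_k0|exact: bounded_k0]. Qed.

Lemma mb_split f : mb f -> exists2 f', mb0 f' & f = cst (inner f 1 / inner k0 1) * k0 + f'.
Proof.
move=> [mf bf]; have mk0 := model_k0; have bk0 := bounded_k0.
exists (f - cst (inner f 1 / inner k0 1) * k0); last by rewrite addrC subrK.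
split; first split.
- by apply: modelB => //; exact: modelZ.
- bounded_auto.
- rewrite innerBl; try L2_auto.
  by rewrite innerZl ?divfK ?subrr ?k0_norm_neq0//; L2_auto.
Qed.

(* The form [inner (Delta * f) g] is invariant under the compressed shift and
   vanishes when [f] or [g] is [k0], hence on all the [kap i], [kap j]. *)
Section null_symbol.
Variable Delta : circle R -> C.
Hypothesis lD : L2 Delta.
Hypothesis D_p : forall g, mb0 g -> inner Delta g = 0.
Hypothesis D_r : forall g, mb0 g -> inner Delta (cj u * g) = 0.
Hypothesis D_k0 : inner (Delta * k0) k0 = 0.

(** This is [D_r] at [u conj f], where [conj u * u] cancels. *)
Let D_q f : mb0 f -> inner Delta (cj f) = 0.
Proof.
move=> mf0; have [[mf bf] f0] := mf0; rewrite -(D_r (mb0_conj mf0)).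
by rewrite inner_cjuuM//; L2_auto.
Qed.

Let pE g : mb g -> inner Delta g = (inner g 1 / inner k0 1)^* * inner Delta k0.
Proof.
move=> mbg; have [g' mg' gE] := mb_split mbg; have [[mg2 bg2] _] := mg'.
have bk0 := bounded_k0.
rewrite {1}gE innerDr; try L2_auto.
by rewrite (D_p mg') addr0 innerZr//; L2_auto.
Qed.

Let qE g : mb g -> inner Delta (cj g) = (inner g 1 / inner k0 1) * inner Delta (cj k0).
Proof.
move=> mbg; have [g' mg' gE] := mb_split mbg; have [[mg2 bg2] _] := mg'.
have bk0 := bounded_k0.
rewrite {1}gE cjD cjM cj_cst innerDr; try L2_auto.
by rewrite (D_q mg') addr0 innerZr ?conjCK//; L2_auto.
Qed.

Let k0_real : (inner k0 1)^* = inner k0 1.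
Proof. by rewrite k0_normE rmorphB rmorph1 rmorphM/= conjCK mulrC. Qed.

(** As [|u| = 1], expanding gives [|k0|^2 = k0 + conj k0 - ||k0||^2] almost everywhere; [D_k0] is
    the pairing of [Delta] with this function. *)
Let D_mean : inner Delta k0 + inner Delta (cj k0) = inner k0 1 * inner Delta 1.
Proof.
have bk0 := bounded_k0.
apply/eqP; rewrite -subr_eq0; apply/eqP; rewrite -[RHS]D_k0.
rewrite [Delta * k0]mulrC innerMl.
have -> : inner Delta (cj k0 * k0) = inner Delta (k0 + cj k0 - cst (inner k0 1)).
  apply: ae_eq_inner => //; try L2_auto; first exact: aeW.
  apply: filterS u_inner.2 => z uz.
  rewrite k0_normE /k0 !fctE /cj !(rmorphB, rmorphM) /= conjCK.
  have uz2 : (u z)^* * u z = 1 by rewrite mulrC -normCK uz expr1n.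
  rewrite /cst /= [(1 z)^*](_ : _ = 1) ?rmorph1//.
  rewrite -[1 z]/(1 : C).
  have -> : (1 - u0 * (u z)^*) * (1 - u0^* * u z) =
     1 - u0^* * u z - u0 * (u z)^* + u0^* * u0 * ((u z)^* * u z) by ring.
  by rewrite uz2; ring.
rewrite innerBr; try L2_auto.
rewrite innerDr; try L2_auto.
by rewrite -[cst _]mulr1 innerZr ?k0_real//; L2_auto.
Qed.

(** Modulo [k0], which [D_k0] handles, [conj k0 * g'] is a combination of [g'] and [conj u * g'],
    annihilated by [D_p] and [D_r]. *)
Let D_k0l g : mb g -> inner (Delta * k0) g = 0.
Proof.
move=> mbg; have [g' mg' ->] := mb_split mbg; have [[mg2 bg2] _] := mg'.
have bk0 := bounded_k0.
rewrite innerDr; try L2_auto.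
rewrite innerZr; try L2_auto.
rewrite D_k0 mulr0 add0r [Delta * k0]mulrC innerMl.
have -> : cj k0 * g' = g' - cst u0 * (cj u * g').
  by rewrite /k0 cjD cjN cjM cj1 cj_cst conjCK; ring.
rewrite innerBr; try L2_auto.
by rewrite innerZr ?(D_p mg') ?(D_r mg') ?mulr0 ?subr0//; L2_auto.
Qed.

Let D_k0r f : mb f -> inner (Delta * f) k0 = 0.
Proof.
move=> mbf; have [f' mf' ->] := mb_split mbf; have [[mf2 bf2] _] := mf'.
have bk0 := bounded_k0.
rewrite mulrDr innerDl; try L2_auto.
rewrite mulrCA innerZl; try L2_auto.
rewrite D_k0 mulr0 add0r [Delta * f']mulrC innerMl.
have -> : cj f' * k0 = cj f' - cst u0^* * (u * cj f') by rewrite /k0; ring.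
rewrite innerBr; try L2_auto.
by rewrite innerZr ?(D_q mf') ?(D_p (mb0_conj mf')) ?mulr0 ?subr0//; L2_auto.
Qed.

(** With [fshift f = z f - a u] and [fshift g = z g - b u], the three correction terms are multiples
    of [a conj(b)]; [pE] and [qE] evaluate two of them, and [D_mean] makes the sum vanish. *)
Let D_shift f g : mb f -> mb g ->
  inner (Delta * fshift f) (fshift g) = inner (Delta * f) g.
Proof.
move=> mbf mbg; have [mf bf] := mbf; have [mg bg] := mbg.
have mean h : mb h -> inner (conjugation u h) 1 = (inner (Z * h) u)^*.
  move=> [mh bh]; rewrite innerC; try L2_auto.
  by rewrite conjugationE mulrC innerMl cjK mulr1.
rewrite /fshift; set a := inner (Z * f) u; set b := inner (Z * g) u.
rewrite mulrBr innerBl; try L2_auto.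
rewrite innerBr; try L2_auto.
rewrite innerBr; try L2_auto.
rewrite [Delta * (Z * f)]mulrCA inner_ZZ.
rewrite [Delta * (cst a * u)]mulrCA !innerZr; try L2_auto.
rewrite !innerZl; try L2_auto.
have -> : inner (Z * (Delta * f)) u = a * (inner Delta k0 / inner k0 1).
  have -> : inner (Z * (Delta * f)) u = inner Delta (conjugation u f).
    by rewrite !innerE conjugationE !cjM !cjK; congr cintegral; ring.
  rewrite pE ?mean//; last exact: mb_conjugation.
  by rewrite -/a rmorphM/= conjCK fmorphV/= k0_real; ring.
have -> : inner (Delta * u) (Z * g) = b^* * (inner Delta (cj k0) / inner k0 1).
  have -> : inner (Delta * u) (Z * g) = inner Delta (cj (conjugation u g)).
    by rewrite !innerE conjugationE !cjM !cjK; congr cintegral; ring.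
  by rewrite qE ?mean//; [rewrite -/b; ring|exact: mb_conjugation].
have -> : inner (Delta * u) u = inner Delta 1.
  by rewrite [Delta * u]mulrC -[X in inner _ X]mulr1 inner_uu//; L2_auto.
have -> : inner Delta 1 = (inner Delta k0 + inner Delta (cj k0)) / inner k0 1.
  by rewrite D_mean mulrAC mulfV ?mul1r// k0_norm_neq0.
by ring.
Qed.

Let D_kap i j : inner (Delta * kap i) (kap j) = 0.
Proof.
elim: i j => [|i IH] j; first by apply: D_k0l; exact: mb_kap.
case: j => [|j]; first by apply: D_k0r; exact: mb_kap.
by rewrite /= D_shift ?IH//; exact: mb_kap.
Qed.

Let inner_0l g : L2 g -> inner 0 g = 0.
Proof. by move=> lg; rewrite -[0 : circle R -> C]/(cst 0) -[cst 0]mulr1 innerZl ?mul0r//; L2_auto. Qed.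

Let inner_0r g : L2 g -> inner g 0 = 0.
Proof.
move=> lg; rewrite -[0 : circle R -> C]/(cst 0) -[cst 0]mulr1 innerZr ?rmorph0 ?mul0r//; L2_auto.
Qed.

Let D_kspan f g : kspan f -> kspan g -> inner (Delta * f) g = 0.
Proof.
move=> kf kg; have [mg bg] := mb_kspan kg.
elim: kf => [|{}f c n kf IH]; first by rewrite mulr0 inner_0l//; L2_auto.
have [mf bf] := mb_kspan kf; have [mk bk] := mb_kap n.
rewrite mulrDr innerDl; try L2_auto.
rewrite mulrCA innerZl; try L2_auto.
rewrite IH add0r; suff -> : inner (Delta * kap n) g = 0 by rewrite mulr0.
elim: kg {mg bg IH} => [|{}g d i kg IH]; first by rewrite inner_0r//; L2_auto.
have [mg bg] := mb_kspan kg; have [mi bi] := mb_kap i.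
rewrite innerDr; try L2_auto.
rewrite innerZr; try L2_auto.
by rewrite IH D_kap mulr0 addr0.
Qed.

Let kspan_orthogonal g h : L2 g -> model u h ->
  (forall k, kspan k -> inner g k = 0) -> inner g h = 0.
Proof.
move=> lg mh H; apply: (@sqn_small _ _ (nsq g)) => e e0.
have [k kk hk] := kspan_dense mh e0; have [mk bk] := mb_kspan kk.
have lhk : L2 (h - k) by L2_auto.
have -> : inner g h = inner g (h - k) by rewrite innerBr ?(H k kk) ?subr0//; L2_auto.
apply: (le_trans (cauchy_schwarz lg lhk)).
by rewrite mulrC ler_wpM2r ?nsq_ge0// ltW.
Qed.

(** [Delta f] is guaranteed to be in [L2] only for bounded [f], so density is used in one variable
    at a time: first in [h], then in [f] after conjugating the form. *)
Lemma null_symbol f h : mb f -> model u h -> inner (Delta * f) h = 0.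
Proof.
move=> [mf bf] mh; apply: kspan_orthogonal => //; first L2_auto.
move=> k kk; have [mk bk] := mb_kspan kk.
have -> : inner (Delta * f) k = (inner (cj Delta * k) f)^*.
  rewrite innerC; try L2_auto.
  by rewrite !innerE !cjM cjK; congr cintegral; ring.
rewrite (_ : inner _ f = 0) ?rmorph0//.
apply: kspan_orthogonal => //; first L2_auto.
move=> k' kk'; have [mk' bk'] := mb_kspan kk'.
have -> : inner (cj Delta * k) k' = (inner (Delta * k') k)^*.
  rewrite innerC; try L2_auto.
  by rewrite !innerE !cjM; congr cintegral; ring.
by rewrite D_kspan ?rmorph0.
Qed.

End null_symbol.

(** As functionals on [mb0], [x = B k0] is [p - conj(u(0)) r] and [y = S_u (B kt)] is [r - u(0) p].
    This system has determinant [1 - |u(0)|^2], nonzero because [u] is not constant, and inverting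
    it gives [phi] and [chi]. *)
Lemma symbol_functionals B Phi : symbol u B Phi -> exists phi chi,
  [/\ model u phi, model u chi,
      forall g, mb0 g -> inner phi g = inner Phi g &
      forall g, mb0 g -> inner chi g = inner Phi (cj u * g)].
Proof.
move=> sB; have lPhi := proj1 sB.
have [mk0 bk0] := mb_k0; have [mkt bkt] : mb kt by split; [exact: model_kt|exact: bounded_kt].
pose x := B k0; pose y := fshift (B kt).
have mx : model u x := symbol_model sB mb_k0.
have mbt : model u (B kt) := symbol_model sB (conj mkt bkt).
have my : model u y := model_fshift mbt.
have n0 := k0_norm_neq0.
have xE g : mb0 g -> inner x g = inner Phi g - u0^* * inner Phi (cj u * g).
  move=> [[mg bg] g0]; rewrite (symbol_inner sB mb_k0 mg) [Phi * k0]mulrC innerMl.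
  have -> : cj k0 * g = g - cst u0 * (cj u * g).
    by rewrite /k0 cjD cjN cjM cj1 cj_cst conjCK; ring.
  rewrite innerBr; try L2_auto.
  by rewrite innerZr//; L2_auto.
have yE g : mb0 g -> inner y g = inner Phi (cj u * g) - u0 * inner Phi g.
  move=> mg0; have [[mg bg] g0] := mg0; have [mzg bzg] := mb0_cjZ mg0.
  rewrite /y /fshift innerBl; try L2_auto.
  rewrite innerZl; try L2_auto.
  rewrite inner_u_model// mulr0 subr0 innerMl (symbol_inner sB (conj mkt bkt) mzg).
  have -> : inner (Phi * kt) (cj Z * g) = inner (Phi * (Z * kt)) g.
    by rewrite [Phi * (Z * kt)]mulrCA (innerMl Z).
  rewrite /kt backward_shiftK mulrBr innerBl; try L2_auto.
  by rewrite [Phi * u]mulrC innerMl [Phi * _]mulrC innerZl//; L2_auto.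
exists (cst (inner k0 1)^-1 * (x + cst u0^* * y)), (cst (inner k0 1)^-1 * (y + cst u0 * x)); split.
- by apply: modelZ; apply: modelD => //; exact: modelZ.
- by apply: modelZ; apply: modelD => //; exact: modelZ.
- move=> g mg0; have [[mg bg] _] := mg0.
  rewrite innerZl; try L2_auto.
  rewrite innerDl; try L2_auto.
  rewrite innerZl; try L2_auto.
  by move: n0; rewrite xE// yE// k0_normE => n0; field.
- move=> g mg0; have [[mg bg] _] := mg0.
  rewrite innerZl; try L2_auto.
  rewrite innerDl; try L2_auto.
  rewrite innerZl; try L2_auto.
  by move: n0; rewrite xE// yE// k0_normE => n0; field.
Qed.

(* A representative of [S_u C f]. *)
Definition costar f : circle R -> C := u * cj (f - cst (inner f 1)).

Lemma costarE f : costar f = conjugation u (backward_shift f).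
Proof. by rewrite conjugationE backward_shiftK. Qed.

Lemma model_costar f : model u f -> model u (costar f).
Proof. by move=> mf; rewrite costarE; apply: model_conjugation; exact: model_backward_shift. Qed.

Lemma costarZ c f : L2 f -> costar (cst c * f) = cst c^* * costar f.
Proof.
move=> lf; rewrite /costar innerZl//; last L2_auto.
by apply/funext => z; rewrite /cj !fctE !(rmorphB, rmorphM)/= /cst; ring.
Qed.

(** [z C f = u conj f] differs from [costar f] by [conj(f(0)) u], which is orthogonal to the model
    space. *)
Lemma compressed_shift_conjugation f : model u f ->
  compressed_shift u (conjugation u f) (costar f).
Proof.
move=> mf; split; first exact: model_costar.
move=> h mh; have mc := model_costar mf.
have -> : inner (fun z => circle_val z * conjugation u f z - costar f z) h =
    inner (cst (inner f 1)^* * u) h.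
  congr inner; apply/funext => z; rewrite /costar /conjugation /cj !fctE rmorphB rmorphM /=.
  have zz : (circle_val z) * (circle_val z)^* = 1 by rewrite mulrC circle_conjM.
  rewrite /cst mulrCA [circle_val z * _]mulrA zz mul1r; ring.
by rewrite innerZl ?inner_u_model ?mulr0//; L2_auto.
Qed.

(** Since [g] is [z] times the analytic function [conj z g], this is the orthogonality of [z H2] and
    [conj H2]. *)
Lemma inner_cj_mb0 f g : H2 f -> mb0 g -> inner (cj f) g = 0.
Proof.
move=> hf mg0; have [[mg bg] _] := mg0; have [[hzg _] _] := mb0_cjZ mg0.
have -> : g = Z * (cj Z * g) by rewrite mulrA [Z * _]mulrC cjZZ mul1r.
by rewrite -innerC ?inner_H2_conj ?rmorph0//; L2_auto.
Qed.

(** On [mb0], [phi] produces the first functional and [conj (costar chi)] the second, without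
    interference; constants contribute to neither. So [c] is free to be fixed by the remaining
    condition of [null_symbol], the one on [k0]. *)
Lemma symbol_normal_form B Phi phi chi : symbol u B Phi ->
  model u phi -> model u chi ->
  (forall g, mb0 g -> inner phi g = inner Phi g) ->
  (forall g, mb0 g -> inner chi g = inner Phi (cj u * g)) ->
  exists c, symbol u B (phi + cj (costar chi) + cst c).
Proof.
move=> sB mphi mchi phiE chiE; have lPhi := proj1 sB.
have mcs := model_costar mchi; have bk0 := bounded_k0.
pose D0 := Phi - (phi + cj (costar chi)).
have lD0 : L2 D0 by rewrite /D0; L2_auto.
pose c := inner (D0 * k0) k0 / inner k0 1.
have k0k0 : inner k0 k0 = inner k0 1 by rewrite inner_k0r//; exact: model_k0.
exists c; pose Delta := D0 - cst c.
have lD : L2 Delta by rewrite /Delta; L2_auto.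
have D_p g : mb0 g -> inner Delta g = 0.
  move=> mg0; have [[mg bg] g0] := mg0.
  rewrite /Delta /D0 innerBl; try L2_auto.
  rewrite innerBl; try L2_auto.
  rewrite innerDl; try L2_auto.
  rewrite -[cst c]mulr1 innerZl; try L2_auto.
  rewrite inner_1r; last L2_auto.
  rewrite g0 phiE// inner_cj_mb0//; last by case: mcs.
  by rewrite rmorph0; ring.
have D_r g : mb0 g -> inner Delta (cj u * g) = 0.
  move=> mg0; have [[mg bg] g0] := mg0.
  rewrite /Delta /D0 innerBl; try L2_auto.
  rewrite innerBl; try L2_auto.
  rewrite innerDl; try L2_auto.
  rewrite -[cst c]mulr1 innerZl; try L2_auto.
  have -> : inner 1 (cj u * g) = 0 by rewrite -innerMl mulr1 inner_u_model.
  have -> : inner phi (cj u * g) = 0.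
    have -> : inner phi (cj u * g) = (inner (cj phi) (u * cj g))^*.
      have [[mJ bJ] _] := mb0_conj mg0.
      rewrite innerC; try L2_auto.
      by rewrite -[in RHS](cjK (u * cj g)) inner_cj cjM cjK.
    by rewrite inner_cj_mb0 ?rmorph0//; [case: mphi|exact: mb0_conj].
  have -> : inner (cj (costar chi)) (cj u * g) = inner chi g.
    rewrite /costar cjM cjK innerMl cjK mulrCA inner_cjuuM; try L2_auto.
    rewrite innerBl; try L2_auto.
    rewrite -[cst (inner chi 1)]mulr1 innerZl; try L2_auto.
    by rewrite inner_1r ?g0 ?rmorph0 ?mulr0 ?subr0//; L2_auto.
  by rewrite chiE//; ring.
have D_k0 : inner (Delta * k0) k0 = 0.
  rewrite /Delta mulrBl innerBl; try L2_auto.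
  by rewrite innerZl ?k0k0 ?divfK ?subrr ?k0_norm_neq0//; L2_auto.
apply: symbolI; first L2_auto.
  by move=> f; exact: symbol_model sB.
move=> f h mbf mh; have [mf bf] := mbf.
rewrite (symbol_inner sB mbf mh).
have := null_symbol lD D_p D_r D_k0 mbf mh.
have -> : Delta * f = Phi * f - (phi + cj (costar chi) + cst c) * f.
  by rewrite /Delta /D0; ring.
rewrite innerBl; try L2_auto.
by move=> /eqP; rewrite subr_eq0 => /eqP.
Qed.

End model_space.

(** * The common type of an algebra *)

Theorem theorem5p5 (R : realType) (u : circle R -> R[i])
    (u_inner : inner_function u) (u_nonconstant : nonconstant u)
    (Alg : set (operator R)) (Alg_algebra : operator_algebra u Alg)
    (Alg_tto : Alg `<=` tto u) :
  exists alpha : option R[i], subalgebra u Alg (tto_of_type u alpha).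
Proof.
have prop A B Phi Psi : Alg A -> Alg B -> symbol u A Phi -> symbol u B Psi ->
    forall f g, mb0 u f -> mb0 u g ->
    inner Psi (cj u * f) * inner Phi g = inner Psi f * inner Phi (cj u * g).
  move=> aA aB sA sB f g.
  have [_ [Xi sAB]] := Alg_tto _ (operator_algebra_comp Alg_algebra aA aB).
  exact: (tto_mul_proportional u_inner (operator_algebra_bounded Alg_algebra aA) sA sB sAB).
have [[A [Phi [g [aA sA mg Ag]]]]|none] := pselect (exists A Phi g,
    [/\ Alg A, symbol u A Phi, mb0 u g & inner Phi g <> 0]).
  have Ag0 : inner Phi g != 0 by exact/eqP.
  (* This value depends on the fixed [A], [Phi] and [g] alone; the relation for the pair [A], [B]
     transfers it to every [B]. *)
  pose alpha := inner Phi (cj u * g) / inner Phi g; exists (Some alpha); split=> // B aB.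
  split; first exact: Alg_tto.
  have [_ [Psi sB]] := Alg_tto _ aB.
  have [phi [chi [mphi _ phiE _]]] := symbol_functionals u_inner u_nonconstant sB.
  have lphi := H2_L2 (proj1 mphi).
  (* [alpha * phi] itself represents the second functional, so it takes the place of [chi] in the
     normal form. *)
  have aphiE f : mb0 u f -> inner (cst alpha * phi) f = inner Psi (cj u * f).
    move=> mf0; have [[[hf _] _] _] := mf0.
    rewrite innerZl//; last exact: H2_L2.
    rewrite phiE// /alpha; apply: (mulIf Ag0).
    by rewrite (prop _ _ _ _ aA aB sA sB _ _ mf0 mg) mulrAC (divfK Ag0) mulrC.
  have [c sc] := symbol_normal_form u_inner u_nonconstant sB mphi
    (modelZ u_inner alpha mphi) phiE aphiE.
  exists phi, (costar u phi), c; split => //.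
    exact: compressed_shift_conjugation.
  (* [costar] is antilinear, so conjugating [costar (alpha phi)] restores [alpha], as the definition
     of type requires. *)
  move: sc; rewrite costarZ// (_ : _ + _ + _ = (fun z => phi z + alpha * (costar u phi z)^* + c))//.
  by apply/funext => z; rewrite /cj !fctE rmorphM/= conjCK.
exists None; split => // B aB; split; first exact: Alg_tto.
have [_ [Psi sB]] := Alg_tto _ aB.
have [_ [chi [_ mchi _ chiE]]] := symbol_functionals u_inner u_nonconstant sB.
have zeroE f : mb0 u f -> inner 0 f = inner Psi f.
  move=> mf0; have [[[hf _] _] _] := mf0.
  have -> : inner Psi f = 0.
    by apply: contra_notP none => Bf; exists B, Psi, f.
  rewrite -[0 : circle R -> R[i]]/(cst 0) -[cst 0]mulr1 innerZl ?mul0r//; last exact: H2_L2.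
  exact: L2_1.
have [c sc] := symbol_normal_form u_inner u_nonconstant sB (model0 u_inner) mchi zeroE chiE.
(* With [phi = 0] the normal form is [conj (costar chi) + c], the conjugate of this element of
   [H2]. *)
exists (costar u chi + cst c^*); split.
  by apply: H2D; [case: (model_costar u_inner mchi)|exact: H2_cst].
move: sc; rewrite (_ : 0 + _ + _ = (fun z => ((costar u chi + cst c^*) z)^*))//.
by apply/funext => z; rewrite !fctE /cj rmorphD/= conjCK add0r.
Qed.
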